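(* Let $r\ge 3$, $d\ge 2$ and $0\le c_1,\dots,c_r\le d-1$ be integers, $\mathbf c=(c_1,\dots,c_r)$. Then, as $Q\to\infty$, $$\rho^r_Q(\mathbf c,d)=\frac{2}{d^2}\prod_{p\mid d}\left(1-\frac1{p^2}\right)^{-1}\sum_{\mathbf k\in\mathcal K^{r-2}(\mathbf c,d)}\mathrm{Area}\big(\mathcal T[\mathbf k]\big)+O\big(rQ^{-1}\log^2 Q\big).$$
   Context: For a positive integer $Q$, the Farey sequence $\mathfrak F_Q$ is the increasing sequence of reduced fractions $a/q\in[0,1]$ with $1\le q\le Q$. An $r$-tuple $(q_1,\dots,q_r)$ of consecutive denominators is the tuple of denominators of $r$ consecutive elements of $\mathfrak F_Q$. For $\mathbf c=(c_1,\dots,c_r)$ with $0\le c_j\le d-1$, let $N^r_Q(\mathbf c,d)$ be the number of $r$-tuples of consecutive denominators in $\mathfrak F_Q$ with $q_j\equiv c_j\pmod d$ for all $j$, and $\rho^r_Q(\mathbf c,d)=N^r_Q(\mathbf c,d)/(\#\mathfrak F_Q-(r-1))$. Let $\mathcal T=\{(x,y)\in\mathbb R^2:0<x\le1,\ 0<y\le 1,\ x+y>1\}$ and $\mathcal T_Q=Q\mathcal T$. For $(x,y)\in\mathcal T$ define $L_{-1}=x$, $L_0=y$ and for $j\ge1$, $L_j=\left\lfloor\frac{1+L_{j-2}}{L_{j-1}}\right\rfloor L_{j-1}-L_{j-2}$, and $k_j(x,y)=\left\lfloor\frac{1+L_{j-2}}{L_{j-1}}\right\rfloor$. For $\mathbf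 k\in(\mathbb N^* )^s$ put $\mathcal T[\mathbf k]=\{(x,y)\in\mathcal T:(k_1(x,y),\dots,k_s(x,y))=\mathbf k\}$. For $Q\ge1$ and a lattice point $(q',q'')\in\mathcal T_Q$ with $\gcd(q',q'')=1$, define $q_1=q'$, $q_2=q''$, and recursively $k_j=\lfloor (Q+q_j)/q_{j+1}\rfloor$, $q_{j+2}=k_jq_{j+1}-q_j$; set $\mathbf q(q',q'')=(q_1,\dots,q_r)$ and $\mathbf k(q',q'')=(k_1,\dots,k_{r-2})$. The set $\mathcal A^{s}$ of admissible vectors consists of all $\mathbf k\in(\mathbb N^* )^s$ of the form $\mathbf k(q',q'')$ for some $Q\ge 1$ and some coprime lattice point $(q',q'')\in\mathcal T_Q$. Finally, $\mathcal K^{r-2}(\mathbf c,d)$ is the set of $\mathbf k\in\mathcal A^{r-2}$ for which there exist $Q\ge1$ and a lattice point $(q',q'')\in\mathcal T_Q$ with $\gcd(q',q'')=1$, $\mathbf k(q',q'')=\mathbf k$ and $\mathbf q(q',q'')\equiv\mathbf c\pmod d$ componentwise. *)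

(* Defs.v *)
From HB Require Import structures.
From mathcomp Require Import all_boot all_order all_algebra.
From mathcomp Require Import all_classical all_reals all_analysis.

Set Implicit Arguments.
Unset Strict Implicit.
Unset Printing Implicit Defensive.

Import Order.TTheory GRing.Theory Num.Theory.
Local Open Scope classical_set_scope.
Local Open Scope ring_scope.

Definition farey (Q : nat) : seq rat :=
  sort <=%R [seq a%:R / q%:R | q <- iota 1 Q,
                               a <- [seq a <- iota 0 q.+1 | coprime a q]].

Definition farey_den (Q i : nat) : nat := `|denq (nth 0%R (farey Q) i)|%N.

(* A tuple of r consecutive elements is identified with the position i of its
   first element; for r >= 2 distinct positions give distinct tuples of
   denominators. *)
Definition num_tuples (r Q : nat) (c : r.-tuple nat) (d : nat) : nat :=
  count (fun i => (i + r <= size (farey Q))%N &&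
           [forall j : 'I_r, farey_den Q (i + j) == tnth c j %[mod d]])
        (iota 0 (size (farey Q))).

Definition rho (R : realType) (r Q : nat) (c : r.-tuple nat) (d : nat) : R :=
  (num_tuples Q c d)%:R / ((size (farey Q))%:R - (r%:R - 1)).

Definition farey_triangle (R : realType) : set (R * R) :=
  [set p | [/\ 0 < p.1 <= 1, 0 < p.2 <= 1 & p.1 + p.2 > 1]].

Definition index_real (R : realType) (p : R * R) : int :=
  Num.floor ((1 + p.1) / p.2).

Definition next_real (R : realType) (p : R * R) : R * R :=
  (p.2, (index_real p)%:~R * p.2 - p.1).

(* (L_{j-1}, L_j), starting from (L_{-1}, L_0) = p. *)
Definition L_pair (R : realType) (p : R * R) (j : nat) : R * R :=
  iter j (@next_real R) p.

(* Positions are counted from 0: the entry i of k is compared with k_{i+1}. *)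
Definition T_region (R : realType) (s : nat) (k : s.-tuple nat) : set (R * R) :=
  [set p | farey_triangle p /\
           forall i : 'I_s, index_real (L_pair p i) = (tnth k i)%:Z].

Definition area (R : realType) (A : set (R * R)) : \bar R :=
  (@lebesgue_measure R \x @lebesgue_measure R)%E A.

(* Coprime lattice points of the triangle scaled by Q. *)
Definition lattice_point (Q : nat) (p : nat * nat) : bool :=
  [&& (0 < p.1 <= Q)%N, (0 < p.2 <= Q)%N, (Q < p.1 + p.2)%N & coprime p.1 p.2].

Definition index_nat (Q : nat) (p : nat * nat) : nat := ((Q + p.1) %/ p.2)%N.

(* The subtraction never truncates on lattice points, since
   k * p.2 > Q + p.1 - p.2 >= p.1; the new pair is again a lattice point. *)
Definition next_nat (Q : nat) (p : nat * nat) : nat * nat :=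
  (p.2, (index_nat Q p * p.2 - p.1)%N).

(* (q_{j+1}, q_{j+2}), starting from (q_1, q_2) = p. *)
Definition q_pair (Q : nat) (p : nat * nat) (j : nat) : nat * nat :=
  iter j (next_nat Q) p.

Definition q_vec (r Q : nat) (p : nat * nat) : r.-tuple nat :=
  [tuple (q_pair Q p j).1 | j < r].

Definition k_vec (s Q : nat) (p : nat * nat) : s.-tuple nat :=
  [tuple index_nat Q (q_pair Q p j) | j < s].

Definition admissible (s : nat) : set (s.-tuple nat) :=
  [set k | (forall i : 'I_s, (0 < tnth k i)%N) /\
           exists (Q : nat) (p : nat * nat),
             [/\ (1 <= Q)%N, lattice_point Q p & k_vec s Q p = k]].

Definition K_set (r : nat) (c : r.-tuple nat) (d : nat) :
    set ((r - 2).-tuple nat) :=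
  [set k | admissible k /\
           exists (Q : nat) (p : nat * nat),
             [/\ (1 <= Q)%N, lattice_point Q p, k_vec (r - 2) Q p = k
               & forall j : 'I_r, tnth (q_vec r Q p) j = tnth c j %[mod d]]].

(* The regions are pairwise disjoint subsets of the triangle, so the (possibly
   infinite) sum is at most 1/2 and [fine] is its real value. *)
Definition total_area (R : realType) (r : nat) (c : r.-tuple nat) (d : nat) : R :=
  fine (\esum_(k in K_set c d) area (@T_region R (r - 2) k))%E.

(* Main.v *)
(** Consecutive denominators of a Farey sequence correspond to coprime lattice
    points of the scaled triangle, and passing to the next pair is a unimodular
    bijection of the lattice points of that triangle. Reduced modulo d, an
    r-tuple of denominators is determined by its first two entries and its
    indices, so the tuples in the class c are the coprime points of the regions
    T[k], k in K(c,d), lying in one residue class. Each region is a polygon: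
    Moebius inversion and comparison of lattice points with square cells give
    its contribution up to O(Q log Q). There are infinitely many k, but once
    r is fixed an index K > 10 (r - 2) + 10 forces all the other indices (1
    beside it, 2 further away), so moving along the sequence reduces that
    region to the one of the single index K, whose diameter is O(1/K) and whose
    error is therefore O(Q log Q / K), uniformly in d; summing over K <= 2Q and
    over the r - 2 positions gives the error r Q log^2 Q. The constants
    attached to the finitely many remaining k depend on r, d and c, but multiply
    only Q log Q. *)
Require Import Defs.
From HB Require Import structures.
From mathcomp Require Import all_boot all_order all_algebra.
From mathcomp Require Import all_classical all_reals all_analysis.
From mathcomp Require Import ring lra zify.

Set Implicit Arguments.
Unset Strict Implicit.
Unset Printing Implicit Defensive.

Import Order.TTheory GRing.Theory Num.Theory.
Import measurable_realfun.
Local Open Scope classical_set_scope.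
Local Open Scope ring_scope.

(** * Moebius sums *)

Section Mobius.
Variable R : realType.

(** The order of the quantifiers shapes the proof: the constant is fixed before [r], [d] and [c],
    while the threshold for [Q] may depend on them. A bound C(r, d, c) Q log Q is therefore
    harmless, being below Q log^2 Q for large Q, and explicit constants are tracked only for the
    tail over large indices. Densities are kept as Moebius sums truncated at Q. The sum over m prime
    to d, divided by the sum over all m, is the Euler product of the statement up to O(1/Q); this is
    obtained one prime of d at a time. Only m prime to d occur, because the residues of two
    neighbouring denominators have no common factor with d. Areas are obtained by counting too: two
    polygons with the same number of lattice points at every scale have the same area. So the
    permutation of the lattice points by the Farey step transports areas as well as counts, and the
    area 1/2 of the triangle comes from its Q (Q + 1) / 2 lattice points. *)

Definition mobius (n : nat) : R :=
  if all (fun p => logn p n == 1%N) (primes n) then (-1) ^+ size (primes n)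
  else 0.

Lemma mobius1 : mobius 1 = 1.
Proof. by rewrite /mobius /= expr0. Qed.

Lemma mobius_norm n : `|mobius n| <= 1.
Proof.
by rewrite /mobius; case: ifP => _; rewrite ?normr0 ?ler01 // normrX normrN1 expr1n.
Qed.

Lemma mobius_primeM p m : prime p -> (0 < m)%N -> ~~ (p %| m)%N ->
  mobius (p * m) = - mobius m.
Proof.
move=> pp m0 pm; have p0 := prime_gt0 pp.
have perm : perm_eq (primes (p * m)) (p :: primes m).
  apply: uniq_perm; rewrite /= ?primes_uniq // ?mem_primes ?(negbTE pm) ?andbF //.
  by move=> q; rewrite primesM // primes_prime // inE in_cons.
rewrite /mobius (perm_all _ perm) (perm_size perm) /= lognM // logn_prime // eqxx.
rewrite lognE (negbTE pm) !andbF /=.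
rewrite (@eq_in_all _ _ (fun q => logn q m == 1%N)); last first.
  move=> q; rewrite mem_primes => /and3P[pq _ qm].
  rewrite lognM // (logn_prime _ pp); have [qp|//] := eqVneq q p.
  by rewrite -qp qm in pm.
by case: ifP; rewrite ?oppr0 // exprS mulN1r.
Qed.

Lemma mobius_primeM0 p m : prime p -> (0 < m)%N -> (p %| m)%N ->
  mobius (p * m) = 0.
Proof.
move=> pp m0 pm; have p0 := prime_gt0 pp.
rewrite /mobius; case: ifP => // /allP /(_ p).
rewrite mem_primes pp muln_gt0 p0 m0 dvdn_mulr // => /(_ isT).
rewrite lognM // logn_prime // eqxx -[1%N]addn0 eqn_add2l.
by rewrite eqn0Ngt logn_gt0 mem_primes pp m0 pm.
Qed.

Lemma sum_multiples (V : nmodType) (p n : nat) (F : nat -> V) : (0 < p)%N ->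
  \sum_(m <- iota 1 n | (p %| m)%N) F m =
  \sum_(m <- iota 1 (n %/ p)) F (p * m)%N.
Proof.
move=> p0; rewrite -big_filter -(big_map (muln p) xpredT F).
apply: perm_big; apply: uniq_perm.
- exact: filter_uniq (iota_uniq _ _).
- rewrite map_inj_uniq ?iota_uniq // => a b /eqP.
  by rewrite eqn_pmul2l // => /eqP.
move=> m; rewrite mem_filter mem_iota; apply/andP/mapP.
  move=> [/dvdnP[k ->] /andP[k1 k2]]; exists k; rewrite 1?mulnC // mem_iota.
  move: k1; rewrite muln_gt0 => /andP[-> _] /=.
  by rewrite add1n ltnS leq_divRL // -ltnS -[_.+1]add1n.
move=> [k]; rewrite mem_iota => /andP[k1 k2] ->; rewrite dvdn_mulr //; split=> //.
by rewrite muln_gt0 p0 k1 /= add1n ltnS mulnC -leq_divRL // -ltnS -[_.+1]add1n.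
Qed.

(** For g > 1 take a prime p dividing g: a divisor m prime to p is paired with p m, which carries
    the opposite sign, and divisors p m with p | m contribute 0. *)
Lemma sum_mobius_dvd n g : (0 < g <= n)%N ->
  \sum_(m <- iota 1 n | (m %| g)%N) mobius m = (g == 1%N)%:R.
Proof.
case/andP=> g0 gn; have [->|g1] := eqVneq g 1%N.
  have n0 : (0 < n)%N by lia.
  rewrite (eq_bigl (fun m => m == 1%N)); last by move=> m; rewrite dvdn1.
  by rewrite -big_filter filter_pred1_uniq ?iota_uniq ?mem_iota ?big_seq1 ?mobius1 //; lia.
have pp : prime (pdiv g) by rewrite pdiv_prime // ltn_neqAle eq_sym g1.
set p := pdiv g in pp; have pg : (p %| g)%N := pdiv_dvd g.
have p0 := prime_gt0 pp.
have pdm m : (p * m %| g)%N -> (m <= n %/ p)%N.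
  by move=> /(dvdn_leq g0) h; rewrite leq_divRL // mulnC; exact: leq_trans gn.
rewrite (bigID (fun m => p %| m)%N) /= (eq_bigl (fun m => (p %| m) && (m %| g))%N);
  last by move=> m; rewrite andbC.
rewrite big_mkcondr /= sum_multiples // addrC.
rewrite [X in X + _](_ : _ = \sum_(m <- iota 1 n | (m <= n %/ p)%N)
    (if (p * m %| g)%N && ~~ (p %| m)%N then mobius m else 0)); last first.
  rewrite big_mkcond [RHS]big_mkcond /= !big_seq; apply: eq_bigr => m.
  rewrite mem_iota => /andP[m0 _]; case pm: (p %| m)%N; first by rewrite /= !andbF; case: ifP.
  rewrite /= !andbT Gauss_dvd ?prime_coprime ?pm // pg /=.
  by case: ifP => mg; rewrite ?if_same // pdm // Gauss_dvd ?prime_coprime ?pm ?pg.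
rewrite [X in X + _](_ : _ = \sum_(m <- iota 1 (n %/ p))
    (if (p * m %| g)%N && ~~ (p %| m)%N then mobius m else 0)); last first.
  rewrite -big_filter; apply: perm_big; apply: uniq_perm.
  - exact: filter_uniq (iota_uniq _ _).
  - exact: iota_uniq.
  move=> m; rewrite mem_filter !mem_iota; have := leq_div n p; lia.
rewrite -big_split big_seq big1 // => m; rewrite mem_iota => /andP[m0 _] /=.
case: (_ %| g)%N; case pm: (p %| m)%N; rewrite /= ?addr0 //.
  by rewrite mobius_primeM0 ?addr0.
by rewrite mobius_primeM ?pm // addrN.
Qed.

(** Partial sum of the Dirichlet series of 1/zeta at 2, with the Euler factors at the primes
    dividing [e] removed. *)
Definition mobius_sum (e n : nat) : R :=
  \sum_(m <- iota 1 n | coprime m e) mobius m / m%:R ^+ 2.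

(** Telescoping, from 1/(x+1)^2 <= 1/x - 1/(x+1). *)
Lemma sum_inv_sqr_le k n : (0 < k)%N ->
  \sum_(m <- iota k.+1 n) (m%:R ^+ 2)^-1 <= k%:R^-1 - (k + n)%:R^-1 :> R.
Proof.
move=> k0; elim: n => [|n IH]; first by rewrite big_nil addn0 subrr.
rewrite (_ : iota k.+1 n.+1 = iota k.+1 n ++ [:: (k.+1 + n)%N]);
  last by rewrite -[n.+1]addn1 iotaD.
rewrite big_cat /= big_seq1; apply: le_trans (lerD IH (lexx _)) _.
have h : (k + n.+1)%:R = (k + n)%:R + 1 :> R by rewrite addnS -natr1.
rewrite addSnnS h; have : 0 < (k + n)%:R :> R by rewrite ltr0n; lia.
set x := (k + n)%:R => x0.
rewrite -subr_ge0 (_ : _ - _ = (x * (x + 1) ^+ 2)^-1); 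
  first by rewrite invr_ge0; apply: mulr_ge0; [exact: ltW | exact: sqr_ge0].
by field; rewrite !gt_eqF ?ltr0n //; lra.
Qed.

Lemma norm_mobius_sum_tail (P : pred nat) k n : (0 < k)%N ->
  `|\sum_(m <- iota k.+1 n | P m) mobius m / m%:R ^+ 2| <= k%:R^-1.
Proof.
move=> k0; apply: (le_trans (ler_norm_sum _ _ _)).
apply: (@le_trans _ _ (\sum_(m <- iota k.+1 n) (m%:R ^+ 2)^-1 : R)).
  rewrite big_mkcond; apply: ler_sum => m _; case: ifP => _; last by rewrite invr_ge0 exprn_ge0.
  rewrite normrM normfV normrX normr_nat ler_piMl ?invr_ge0 ?exprn_ge0 //.
  exact: mobius_norm.
by apply: (le_trans (sum_inv_sqr_le _ k0)); rewrite gerBl invr_ge0.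
Qed.

(** The terms m = 1 and m = 2 give 3/4, and the tail from 3 on is at most 1/2. This is what makes
    the Farey sequence have at least a constant times Q^2 elements. *)
Lemma mobius_sum1_ge n : (0 < n)%N -> 4^-1 <= mobius_sum 1 n.
Proof.
rewrite /mobius_sum; under eq_bigl do rewrite coprimen1.
case: n => // -[|n] _ /=; rewrite !big_cons ?big_nil mobius1 expr1n divr1.
  by rewrite addr0; lra.
have -> : mobius 2 = -1.
  by rewrite (_ : 2 = 2 * 1)%N // mobius_primeM // mobius1.
have := norm_mobius_sum_tail xpredT n (isT : (0 < 2)%N).
by rewrite ler_norml => /andP[h _]; move: h; set s := bigop _ _ _; lra.
Qed.

(** Writing S(e, n) for the sum, the terms with p | m give S(e, n) = S(p e, n) - p^-2 S(p e, n/p),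
    since mu(p m) is - mu(m) for m prime to p and 0 otherwise. Replacing n/p by n then costs only a
    tail. *)
Lemma mobius_sum_primeM e p n : prime p -> ~~ (p %| e)%N -> (0 < n)%N ->
  `|mobius_sum e n - (1 - 1 / p%:R ^+ 2) * mobius_sum (p * e) n|
    <= 2 / p%:R / n%:R.
Proof.
move=> pp pe n0; have p0 := prime_gt0 pp; have p1 := prime_gt1 pp.
have pR : 0 < p%:R :> R by rewrite ltr0n.
have nR : 0 < n%:R :> R by rewrite ltr0n.
have cpe m : coprime m (p * e) = ~~ (p %| m)%N && coprime m e.
  by rewrite coprimeMr coprime_sym prime_coprime.
have -> : mobius_sum e n = mobius_sum (p * e) n
    - 1 / p%:R ^+ 2 * mobius_sum (p * e) (n %/ p).
  rewrite /mobius_sum (bigID (fun m => p %| m)%N) /= addrC; congr (_ + _).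
    by apply: eq_bigl => m; rewrite cpe andbC.
  rewrite (eq_bigl (fun m => (p %| m)%N && coprime m e)); last by move=> m; rewrite andbC.
  rewrite big_mkcondr sum_multiples // mulr_sumr -sumrN [RHS]big_mkcond /= !big_seq.
  apply: eq_bigr => m; rewrite mem_iota => /andP[m0 _].
  rewrite cpe coprimeMl prime_coprime // pe /=.
  case: ifP => _; rewrite ?andbF ?andbT //; case: ifP => pm.
    rewrite mobius_primeM // natrM; field.
    by rewrite !pnatr_eq0; lia.
  by rewrite mobius_primeM0 ?mul0r //; move/negbFE: pm.
rewrite (_ : _ - _ = 1 / p%:R ^+ 2 * (mobius_sum (p * e) n - mobius_sum (p * e) (n %/ p)));
  last by ring.
rewrite normrM ger0_norm; last by rewrite divr_ge0 ?exprn_ge0 ?ltW.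
(* The tail beyond [n %/ p] is at most the inverse of [n %/ p], hence below 2 p / n. For n < p the
   shorter sum is empty and the longer one is at most 2. *)
have tail : `|mobius_sum (p * e) n - mobius_sum (p * e) (n %/ p)| <= 2 * p%:R / n%:R.
  have [np|np] := posnP (n %/ p).
    have lt : (n < p)%N by rewrite ltnNge -divn_gt0 // np.
    rewrite np /mobius_sum big_nil subr0.
    case: n n0 nR np lt => // n n0 nR _ lt.
    rewrite (_ : iota 1 n.+1 = [:: 1%N] ++ iota 2 n) // big_cat big_cons big_nil /=.
    rewrite coprime1n mobius1 expr1n divr1 addr0.
    apply: le_trans (ler_normD _ _) _; rewrite normr1.
    apply: (@le_trans _ _ 2); last first.
      by rewrite -mulrA ler_peMr // ler_pdivlMr // mul1r ler_nat ltnW.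
    have := norm_mobius_sum_tail (fun m => coprime m (p * e)) n (isT : (0 < 1)%N).
    by rewrite invr1; lra.
  have le := leq_div n p.
  rewrite /mobius_sum -{1}(subnKC le) iotaD big_cat /= addrAC subrr add0r add1n.
  apply: le_trans (norm_mobius_sum_tail _ _ np) _.
  have : (n < 2 * p * (n %/ p))%N.
    have := ltn_pmod n p0; have := divn_eq n p; nia.
  rewrite -(ltr_nat R) !natrM => h.
  have q0 : 0 < (n %/ p)%:R :> R by rewrite ltr0n.
  by rewrite ler_pdivlMr // ler_pdivrMl // mulrC; apply: ltW; move: h; lra.
apply: (@le_trans _ _ (1 / p%:R ^+ 2 * (2 * p%:R / n%:R))).
  by apply: ler_wpM2l tail; rewrite divr_ge0 ?exprn_ge0 ?ltW.
by rewrite le_eqVlt; apply/orP; left; apply/eqP; field; rewrite !gt_eqF.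
Qed.

Lemma mobius_sum_norm_le e n : `|mobius_sum e n| <= 2.
Proof.
rewrite /mobius_sum; case: n => [|n]; first by rewrite big_nil normr0.
rewrite (_ : iota 1 n.+1 = [:: 1%N] ++ iota 2 n) // big_cat big_cons big_nil /=.
rewrite coprime1n mobius1 expr1n divr1 addr0.
apply: le_trans (ler_normD _ _) _; rewrite normr1.
have := norm_mobius_sum_tail (fun m => coprime m e) n (isT : (0 < 1)%N).
by rewrite invr1; lra.
Qed.

Lemma prime_factor_pos (p : nat) : prime p -> 0 < 1 - 1 / p%:R ^+ 2 :> R.
Proof.
move=> pp; rewrite subr_gt0 ltr_pdivrMr ?exprn_gt0 ?ltr0n ?prime_gt0 //.
by rewrite mul1r -natrX ltr1n expnS expn1; have := prime_gt1 pp; nia.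
Qed.

Lemma mobius_sum_prod (s : seq nat) : uniq s -> all prime s ->
  exists C : R, forall n, (0 < n)%N ->
   `|(\prod_(p <- s) (1 - 1 / p%:R ^+ 2)^-1) * mobius_sum 1 n
     - mobius_sum (\prod_(p <- s) p) n| <= C / n%:R.
Proof.
elim: s => [|p s IH] /=.
  by move=> _ _; exists 0 => n _; rewrite !big_nil mul1r subrr normr0 mul0r.
move=> /andP[ps us] /andP[pp als]; have [C hC] := IH us als.
have pe : ~~ (p %| \prod_(q <- s) q)%N.
  rewrite Euclid_dvd_prod // big_has; apply/hasPn => q qs.
  rewrite dvdn_prime2 //; last exact: (allP als).
  by apply: contraNneq ps => ->; exact: qs.
have f0 := prime_factor_pos pp.
exists ((1 - 1 / p%:R ^+ 2)^-1 * (C + 2 / p%:R)) => n n0.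
rewrite !big_cons; move: (mobius_sum_primeM pp pe n0) (hC _ n0).
move: (\prod_(q <- s) q)%N pe => e pe.
move: (mobius_sum (p * e) n) (mobius_sum e n) (mobius_sum 1 n) => S' T S.
move: (\prod_(q <- s) _) => P h1 h2; set f := 1 - 1 / p%:R ^+ 2 in f0 h1 *.
have -> : f^-1 * P * S - S' = f^-1 * ((P * S - T) + (T - f * S')).
  by field; rewrite gt_eqF.
rewrite normrM gtr0_norm ?invr_gt0 // -mulrA.
apply: ler_wpM2l; first by rewrite invr_ge0 ltW.
rewrite [X in _ <= X]mulrDl; apply: le_trans (ler_normD _ _) _; exact: lerD.
Qed.

Lemma prod_primes_coprime d m : (0 < d)%N -> (0 < m)%N ->
  coprime m (\prod_(p <- primes d) p) = coprime m d.
Proof.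
move=> d0 m0; have -> s : coprime m (\prod_(p <- s) p) = all (coprime m) s.
  by elim: s => [|p s IH]; rewrite ?big_nil ?coprimen1 // big_cons coprimeMr IH.
apply/allP/idP => h.
  rewrite coprime_has_primes //; apply/hasPn => p; rewrite mem_primes => /and3P[pp _ pm].
  apply/negP; rewrite mem_primes => /and3P[_ _ pm'].
  by have := h p; rewrite mem_primes pp d0 pm coprime_sym prime_coprime // pm' => /(_ isT).
move=> p; rewrite mem_primes => /and3P[pp _ pd].
exact: coprime_dvdr pd h.
Qed.

Lemma sum_inv_le_ln n : (0 < n)%N -> \sum_(m <- iota 1 n) m%:R^-1 <= 1 + ln n%:R :> R.
Proof.
elim: n => // -[|n] IH _; first by rewrite big_seq1 ln1 invr1 addr0.
rewrite (_ : iota 1 n.+2 = iota 1 n.+1 ++ [:: n.+2]); last by have := iotaD 1 n.+1 1; rewrite addn1.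
rewrite big_cat big_seq1.
apply: le_trans (lerD (IH isT) (lexx _)) _; rewrite -addrA lerD2l.
have n1 : 0 < n.+1%:R :> R by rewrite ltr0n.
have n2 : 0 < n.+2%:R :> R by rewrite ltr0n.
have q : n.+1%:R / n.+2%:R = 1 + (- n.+2%:R^-1) :> R.
  by rewrite -[in RHS]natr1 -natr1; field; rewrite natr1 gt_eqF.
have := @le_ln1Dx R (- n.+2%:R^-1); rewrite -q ln_div ?posrE //.
have : -1 < - n.+2%:R^-1 :> R by rewrite ltrN2 invf_lt1 // ltr1n.
by move=> h1 /(_ h1); move: (ln _) (ln _) (_^-1) => x y z; lra.
Qed.
End Mobius.

(** * Areas of polygons and lattice points *)

Section Polygon.
Variable R : realType.

(* ((u, v), (w, strict)) stands for u x + v y <= w, or < w if strict. *)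
Definition half_plane : Type := (R * R) * (R * bool).

Definition in_half_plane (H : half_plane) (z : R * R) : bool :=
  let e := H.1.1 * z.1 + H.1.2 * z.2 in
  if H.2.2 then e < H.2.1 else e <= H.2.1.

Definition in_polygon (Hs : seq half_plane) (z : R * R) : bool :=
  all (in_half_plane^~ z) Hs.

Lemma measurable_half_plane H : measurable [set z | in_half_plane H z].
Proof.
have mf : measurable_fun setT (fun z : R * R => H.1.1 * z.1 + H.1.2 * z.2).
  by apply: measurable_funD; apply: measurable_funM => //; exact: measurable_cst.
rewrite (_ : [set z | _] = (fun z : R * R => H.1.1 * z.1 + H.1.2 * z.2) @^-1`
    [set` if H.2.2 then `]-oo, H.2.1[ else `]-oo, H.2.1]]).
  by rewrite -[X in measurable X]setTI; apply: mf => //; exact: measurable_itv.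
by apply/seteqP; split => z; rewrite /in_half_plane /=; case: ifP => _; rewrite in_itv.
Qed.

Lemma measurable_polygon Hs : measurable [set z | in_polygon Hs z].
Proof.
elim: Hs => [|H Hs IH]; first by rewrite (_ : [set z | _] = setT) //; apply/seteqP; split.
rewrite (_ : [set z | _] = [set z | in_half_plane H z] `&` [set z | in_polygon Hs z]).
  by apply: measurableI => //; exact: measurable_half_plane.
by apply/seteqP; split => z; rewrite /in_polygon /= => /andP.
Qed.

Lemma area_rectangle (x0 x1 y0 y1 : R) : x0 <= x1 -> y0 <= y1 ->
  area (`]x0, x1] `*` `]y0, y1]) = ((x1 - x0) * (y1 - y0))%:E.
Proof.
move=> hx hy; rewrite /area.
rewrite product_measure1E; try exact: measurable_itv.
rewrite EFinM; congr (_ * _)%E.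
- apply: etrans (lebesgue_measure_itv _) _; rewrite /= lte_fin; case: ltP => // h.
  by rewrite (_ : x1 - x0 = 0) //; lra.
- apply: etrans (lebesgue_measure_itv _) _; rewrite /= lte_fin; case: ltP => // h.
  by rewrite (_ : y1 - y0 = 0) //; lra.
Qed.

Lemma measurable_rectangle (x0 x1 y0 y1 : R) :
  measurable (`]x0, x1] `*` `]y0, y1] : set (R * R)).
Proof. by apply: measurableX; exact: measurable_itv. Qed.

(** * Square cells and the boundary lines that cross them *)

Section Cells.
Variables (a b h : R).
Hypothesis h0 : 0 < h.

(** In the application h = M / Q and (a, b) is a scaled lattice point, so that the nodes are the
    scaled lattice points of one residue class modulo M. *)
Definition node (t : nat * nat) : R * R := (a + h * t.1%:R, b + h * t.2%:R).

(** Half-open, with the node as its upper right corner, so that distinct cells are disjoint and each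
    contains exactly one node. *)
Definition cell (t : nat * nat) : set (R * R) :=
  `](node t).1 - h, (node t).1] `*` `](node t).2 - h, (node t).2].

Definition cells (s : seq (nat * nat)) : set (R * R) :=
  [set z | exists2 t, t \in s & cell t z].

Lemma cells_cons t s : cells (t :: s) = cell t `|` cells s.
Proof.
apply/seteqP; split => z.
  by move=> [t']; rewrite inE => /orP[/eqP->|ts] tz; [left|right; exists t'].
by move=> [tz|[t' ts tz]]; [exists t|exists t'] => //; rewrite inE ?eqxx ?ts ?orbT.
Qed.

Lemma measurable_cells s : measurable (cells s).
Proof.
elim: s => [|t s IH].
  by rewrite (_ : cells [::] = set0) //; apply/seteqP; split => // z [].
by rewrite cells_cons; apply: measurableU => //; exact: measurable_rectangle.
Qed.

Lemma mem_cell_coord (c x : R) (i j : nat) :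
  c + h * i%:R - h < x <= c + h * i%:R -> c + h * j%:R - h < x <= c + h * j%:R -> i = j.
Proof.
move=> /andP[i1 i2] /andP[j1 j2].
have A : h * i%:R < h * (j%:R + 1) by lra.
have B : h * j%:R < h * (i%:R + 1) by lra.
move: A B; rewrite !ltr_pM2l // !natr1 !ltr_nat; lia.
Qed.

Lemma cell_inj t t' z : cell t z -> cell t' z -> t = t'.
Proof.
move=> [/= t1 t2] [/= t1' t2']; move: t1 t2 t1' t2'; rewrite !in_itv /= => t1 t2 t1' t2'.
case: t t' t1 t2 t1' t2' => [t1 t2] [u1 u2] /= e1 e2 e1' e2'.
by congr pair; [exact: mem_cell_coord e1 e1' | exact: mem_cell_coord e2 e2'].
Qed.

Lemma area_cells s : uniq s -> area (cells s) = ((size s)%:R * h ^+ 2)%:E.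
Proof.
elim: s => [|t s IH] /=.
  move=> _; rewrite (_ : cells [::] = set0) ?mul0r /area ?measure0 //.
  by apply/seteqP; split => // z [].
move=> /andP[ts us]; rewrite cells_cons /area measureU.
- transitivity (area (cell t) + area (cells s))%E => //.
  rewrite IH // area_rectangle; try by rewrite gerBl ltW.
  by rewrite -EFinD; congr EFin; rewrite -natr1; ring.
- exact: measurable_rectangle.
- exact: measurable_cells.
apply/seteqP; split => // z [tz [t' t's t'z]].
by rewrite (cell_inj tz t'z) t's in ts.
Qed.

Definition grid n : seq (nat * nat) := [seq (i, j) | i <- iota 0 n, j <- iota 0 n].

Lemma grid_uniq n : uniq (grid n).
Proof. by apply: allpairs_uniq; rewrite ?iota_uniq // => -[i j] [i' j'] _ _ [-> ->]. Qed.

Lemma mem_grid n t : (t \in grid n) = (t.1 < n)%N && (t.2 < n)%N.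
Proof.
apply/allpairsP/andP => [[[i j] [/=]]|[]].
  by rewrite !mem_iota => /andP[_ ?] /andP[_ ?] ->.
by move=> t1 t2; exists t; rewrite !mem_iota; split=> //; case: t {t1 t2}.
Qed.

(* The boundary line of H passes through the cell of t only if the linear form
   is, at the node of t, within 2 h max(|u|,|v|) of its value on the line. *)
Definition bad (H : half_plane) (t : nat * nat) : bool :=
  let: (u, v, (w, _)) := H in
  let g := u * (node t).1 + v * (node t).2 - w in
  ((u != 0) || (v != 0)) && (`|g| <= 2 * h * Num.max `|u| `|v|).

(** Inside a cell the linear form moves by at most h (|u| + |v|) <= 2 h max(|u|, |v|), so it stays
    strictly on one side of the boundary value; strict and weak inequalities then behave alike. *)
Lemma not_bad H t z : ~~ bad H t -> cell t z ->
  in_half_plane H z = in_half_plane H (node t).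
Proof.
case: H => [[u v] [w e]]; rewrite /bad /in_half_plane /=.
set n1 := a + _; set n2 := b + _ => G [/=]; rewrite !in_itv /= => z1 z2.
have [[->->]|uv] : (u = 0 /\ v = 0) \/ (u != 0) || (v != 0).
  by case: (eqVneq u 0) (eqVneq v 0) => [->|?] [->|?]; [left|right|right|right].
  by rewrite !mul0r.
move: G; rewrite uv -ltNge /=; set M := Num.max _ _ => G.
have M0 : 0 < M by rewrite lt_max !normr_gt0.
have near (x m c : R) : `|c| <= M -> m - h < x <= m -> `|c * x - c * m| <= h * M.
  move=> cM /andP[x1 x2]; rewrite -mulrBr normrM mulrC; apply: ler_pM => //.
  by rewrite ler_norml; apply/andP; split; lra.
have hu := near _ _ u _ z1; have hv := near _ _ v _ z2.
have {hu} : `|u * z.1 - u * n1| <= h * M by apply: hu; rewrite le_max lexx.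
have {hv} : `|v * z.2 - v * n2| <= h * M by apply: hv; rewrite le_max lexx orbT.
rewrite !ler_norml => /andP[v1 v2] /andP[u1 u2].
rewrite -mulrA in G; move: v1 v2 u1 u2 G; move: (u * z.1) (u * n1) (v * z.2) (v * n2) (h * M) => A A' B B' hM.
move=> v1 v2 u1 u2; rewrite ltr_normr => /orP[G|G].
  by case: e => /=; apply/idP/idP => ?; lra.
by case: e => /=; apply/idP/idP => ?; lra.
Qed.

Lemma count_near (x : R) n : (count (fun i : nat => (`|x + i%:R| <= 2)%R) (iota 0 n) <= 5)%N.
Proof.
rewrite -size_filter; pose s := [seq i : nat <- iota 0 n | (`|x + i%:R| <= 2)%R]; rewrite -/s.
have us : uniq s by rewrite filter_uniq ?iota_uniq.
case E : s => [//|i0 s'].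
have si i : i \in s -> `|x + i%:R| <= 2 by rewrite mem_filter => /andP[].
have sorteds : sorted leq s by rewrite sorted_filter ?iota_sorted //; exact: leq_trans.
have i0s : i0 \in s by rewrite E mem_head.
have sub : {subset s <= iota i0 5}.
  move=> i is_; rewrite mem_iota; apply/andP; split.
    move: sorteds is_; rewrite E /= => /(order_path_min leq_trans)/allP le0.
    by rewrite inE => /orP[/eqP->//|/le0].
  have := si _ is_; have := si _ i0s; rewrite !ler_norml => /andP[a1 a2] /andP[a3 a4].
  rewrite -(ltr_nat R) natrD; lra.
by rewrite -E; exact: uniq_leq_size us sub.
Qed.

Lemma count_near_scaled (g u : R) n : u != 0 ->
  (count (fun i : nat => (`|g + u * (h * i%:R)| <= 2 * h * `|u|)%R) (iota 0 n) <= 5)%N.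
Proof.
move=> u0; rewrite (eq_count (a2 := fun i : nat => (`|g / (u * h) + i%:R| <= 2)%R)).
  exact: count_near.
move=> i /=; rewrite (_ : g + _ = u * h * (g / (u * h) + i%:R)); last first.
  by field; rewrite u0 gt_eqF.
rewrite normrM [`|u * h|]normrM (gtr0_norm h0) (_ : 2 * h * `|u| = `|u| * h * 2); last by ring.
by rewrite ler_pM2l // mulr_gt0 ?normr_gt0.
Qed.

Lemma count_allpairs (P : pred (nat * nat)) (s1 s2 : seq nat) :
  count P [seq (i, j) | i <- s1, j <- s2] =
  (\sum_(i <- s1) count (fun j => P (i, j)) s2)%N.
Proof.
elim: s1 => [|i s1 IH] /=; first by rewrite big_nil.
by rewrite big_cons count_cat IH count_map; congr addn; exact: eq_count.
Qed.

(** Fix the coordinate with the smaller coefficient. Each step along the other one moves the form by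
    h max(|u|, |v|), a quarter of the width of the bad window, so every grid line has at most 5 bad
    cells, whatever the slope. *)
Lemma count_bad H n : (count (bad H) (grid n) <= 5 * n)%N.
Proof.
case: H => [[u v] [w e]].
have sum5 (F : nat -> nat) : (forall i, F i <= 5)%N -> (\sum_(i <- iota 0 n) F i <= 5 * n)%N.
  move=> F5; apply: (@leq_trans (\sum_(i <- iota 0 n) 5)%N); first exact: leq_sum.
  by rewrite big_const_seq count_predT size_iota iter_addn_0 mulnC.
have [uv|uv] := leP `|u| `|v|.
  rewrite count_allpairs; apply: sum5 => i.
  have [v0|v0] := eqVneq v 0.
    have u0 : u = 0 by apply/eqP; move: uv; rewrite v0 normr0 normr_le0.
    by rewrite (eq_count (a2 := pred0)) ?count_pred0 // => j; rewrite /bad u0 v0 eqxx.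
  apply: leq_trans (count_near_scaled (u * (a + h * i%:R) + v * b - w) n v0).
  apply: sub_count => j /=; rewrite /bad /= => /andP[_].
  rewrite (_ : u * _ + v * (b + _) - w = u * (a + h * i%:R) + v * b - w + v * (h * j%:R));
    last by ring.
  by move/le_trans; apply; rewrite ler_pM2l ?mulr_gt0 // ge_max uv lexx.
have u0 : u != 0 by rewrite -normr_gt0 (le_lt_trans _ uv).
(* The first coordinate now has the larger coefficient: the grid is transposed so that the inner
   count runs along it. *)
rewrite (_ : count _ _ = count (fun t => bad (u, v, (w, e)) (t.2, t.1)) (grid n)); last first.
  rewrite -(count_map (fun t => (t.2, t.1))); apply/permP; apply: uniq_perm.
  - exact: grid_uniq.
  - by rewrite map_inj_uniq ?grid_uniq // => -[i j] [i' j'] [-> ->].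
  move=> [i j]; rewrite mem_grid andbC; apply/idP/mapP => [ij|[[i' j']]].
    by exists (j, i); rewrite ?mem_grid.
  by rewrite mem_grid => ij [-> ->].
rewrite count_allpairs; apply: sum5 => i.
apply: leq_trans (count_near_scaled (u * a + v * (b + h * i%:R) - w) n u0).
apply: sub_count => j /=; rewrite /bad /= => /andP[_].
rewrite (_ : u * _ + v * (b + _) - w = u * a + v * (b + h * i%:R) - w + u * (h * j%:R));
  last by ring.
by move/le_trans; apply; rewrite ler_pM2l ?mulr_gt0 // ge_max (ltW uv) lexx.
Qed.

Definition bad_any (Hs : seq half_plane) t := has (bad^~ t) Hs.

Lemma count_bad_any Hs n : (count (bad_any Hs) (grid n) <= size Hs * (5 * n))%N.
Proof.
elim: Hs => [|H Hs IH] /=.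
  by rewrite (eq_count (a2 := pred0)) ?count_pred0.
rewrite (eq_count (a2 := predU (bad H) (bad_any Hs))) //.
rewrite mulSn; apply: leq_trans (leq_add (count_bad H n) IH).
by rewrite -count_predUI leq_addr.
Qed.

Lemma not_bad_any Hs t z : ~~ bad_any Hs t -> cell t z ->
  in_polygon Hs z = in_polygon Hs (node t).
Proof.
rewrite /bad_any -all_predC => /allP nb tz; apply: eq_in_all => H HHs.
exact: not_bad (nb _ HHs) tz.
Qed.

(** The polygon contains the good cells whose node lies in it and is covered by these together with
    the bad cells; both families differ from the set of nodes in the polygon by bad cells only. *)
Lemma area_polygon_count Hs n :
  (forall z, in_polygon Hs z -> cells (grid n) z) ->
  exists2 A : R, area [set z | in_polygon Hs z] = A%:E &
  `|(count (fun t => in_polygon Hs (node t)) (grid n))%:R * h ^+ 2 - A|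
     <= (size Hs * (5 * n))%:R * h ^+ 2.
Proof.
move=> cover; set P := [set z | _]; set G := (fun t => in_polygon Hs (node t)).
pose s1 := [seq t <- grid n | G t && ~~ bad_any Hs t].
pose s2 := [seq t <- grid n | G t || bad_any Hs t].
have us1 : uniq s1 by rewrite filter_uniq ?grid_uniq.
have us2 : uniq s2 by rewrite filter_uniq ?grid_uniq.
have sub1 : cells s1 `<=` P.
  move=> z [t]; rewrite mem_filter => /andP[/andP[Gt nb] _] tz.
  by rewrite /P /= (not_bad_any nb tz).
have sub2 : P `<=` cells s2.
  move=> z Pz; have [t tg tz] := cover _ Pz; exists t => //.
  rewrite mem_filter tg andbT; case: (boolP (bad_any Hs t)); rewrite ?orbT // => nb.
  by rewrite orbF /G -(not_bad_any nb tz).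
have mP := measurable_polygon Hs.
have le1 : (area (cells s1) <= area P)%E.
  by apply: le_measure => //; rewrite inE //; exact: measurable_cells.
have le2 : (area P <= area (cells s2))%E.
  by apply: le_measure => //; rewrite inE //; exact: measurable_cells.
rewrite area_cells // in le1; rewrite area_cells // in le2.
have fP : area P \is a fin_num.
  rewrite fin_numE; apply/andP; split.
    by apply: contraTneq le1 => ->.
  by apply: contraTneq le2 => ->.
exists (fine (area P)); first by rewrite fineK.
move: le1 le2; rewrite -(fineK fP) !lee_fin; move: (fine _) => A le1 le2.
have cb := count_bad_any Hs n.
have c1 : (count G (grid n) <= size s1 + size Hs * (5 * n))%N.
  rewrite size_filter; apply: leq_trans (leq_add (leqnn _) cb).
  rewrite -count_predUI; apply: leq_trans (leq_addr _ _); apply: sub_count => t /= ->.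
  by case: bad_any.
have c2 : (size s2 <= count G (grid n) + size Hs * (5 * n))%N.
  rewrite size_filter; apply: leq_trans (leq_add (leqnn _) cb).
  by rewrite -count_predUI leq_addr.
move: c1 c2; rewrite -!(ler_nat R) !natrD; have : 0 < h ^+ 2 by rewrite exprn_gt0.
move: (h ^+ 2) le1 le2 => y le1 le2 y0 c1 c2.
have d1 := ler_wpM2r (ltW y0) c1; have d2 := ler_wpM2r (ltW y0) c2.
by rewrite !mulrDl in d1 d2; rewrite ler_norml /=; apply/andP; split; lra.
Qed.

End Cells.
End Polygon.

(** * Lattice points of a residue class in a polygon *)

Definition points (Q : nat) : seq (nat * nat) :=
  [seq (x, y) | x <- iota 1 Q, y <- iota 1 Q].

Lemma points_uniq Q : uniq (points Q).
Proof. by apply: allpairs_uniq; rewrite ?iota_uniq // => -[i j] [i' j'] _ _ [-> ->]. Qed.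

Lemma mem_points Q t : (t \in points Q) = (0 < t.1 <= Q)%N && (0 < t.2 <= Q)%N.
Proof.
apply/allpairsP/idP => [[[i j] [/=]]|H].
  by rewrite !mem_iota => i1 j1 -> /=; lia.
by exists t; rewrite !mem_iota; split; [lia | lia | case: t {H}].
Qed.

Lemma count_bij (T1 T2 : eqType) (f : T1 -> T2) (s1 : seq T1) (s2 : seq T2)
    (P1 : pred T1) (P2 : pred T2) :
  uniq s1 -> uniq s2 -> {in s1 &, injective f} ->
  (forall x, x \in s1 -> P1 x -> (f x \in s2) && P2 (f x)) ->
  (forall y, y \in s2 -> P2 y -> exists x, [/\ x \in s1, P1 x & f x = y]) ->
  count P1 s1 = count P2 s2.
Proof.
move=> u1 u2 fi h1 h2; rewrite -!size_filter -(size_map f); apply: perm_size.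
apply: uniq_perm; last 1 first.
- move=> y; rewrite mem_filter; apply/mapP/andP => [[x]|[Py ys]].
    by rewrite mem_filter => /andP[Px xs] ->; have /andP[] := h1 _ xs Px.
  by have [x [xs Px <-]] := h2 _ ys Py; exists x; rewrite // mem_filter Px.
- rewrite map_inj_in_uniq ?filter_uniq // => x y; rewrite !mem_filter.
  by move=> /andP[_ xs] /andP[_ ys]; exact: fi.
- exact: filter_uniq.
Qed.

Lemma natr_count (V : pzRingType) (T : Type) (P : pred T) (s : seq T) :
  (count P s)%:R = \sum_(t <- s) (P t)%:R :> V.
Proof. by elim: s => [|t s IH]; rewrite ?big_nil // big_cons /= natrD IH. Qed.

Section LatticePoints.
Variable R : realType.

Definition scaled (Q : nat) (t : nat * nat) : R * R :=
  (t.1%:R / Q%:R, t.2%:R / Q%:R).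

Definition polygon_area (Hs : seq (half_plane R)) : R :=
  fine (area [set z | in_polygon Hs z]).

Lemma minimal_above (x : R) :
  exists i : nat, x <= i%:R /\ (i = 0%N \/ i%:R - 1 < x).
Proof.
have ex : exists i : nat, x <= i%:R by exists (Num.truncn x).+1; rewrite ltW // truncnS_gt.
case: (ex_minnP ex) => i xi mi; exists i; split => //.
case: i xi mi => [|i] xi mi; [by left | right].
by rewrite -natr1 addrK ltNge; apply/negP => /mi; rewrite ltnn.
Qed.

Lemma natr_div_itv (x Q : nat) : (0 < Q)%N ->
  (0 < (x%:R / Q%:R : R)) && ((x%:R / Q%:R : R) <= 1) = (0 < x <= Q)%N.
Proof.
move=> Q0; have QR : 0 < Q%:R :> R by rewrite ltr0n.
by rewrite ler_pdivrMr // mul1r ler_nat pmulr_lgt0 ?invr_gt0 // ltr0n.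
Qed.

Lemma cell_index (a h x s : R) n : 0 < h -> a - h < x -> x - a <= s -> s < h * (n%:R - 1) ->
  exists2 i, (i < n)%N & a + h * i%:R - h < x <= a + h * i%:R.
Proof.
move=> h0 ax xs sn; have [i [i1 i2]] := minimal_above ((x - a) / h).
rewrite ler_pdivrMr // in i1.
have i3 : a + h * i%:R - h < x.
  by case: i2 => [->|]; [rewrite mulr0 addr0 | rewrite ltr_pdivlMr //; lra].
exists i; last by rewrite i3 /=; lra.
have : h * i%:R < h * n%:R by lra.
by rewrite ltr_pM2l // ltr_nat.
Qed.

(** The grid of mesh M / Q through the class is laid over the enclosing box only, so the error is
    proportional to the side s of the box; small regions profit from this. The bounds 0 < z <= 1
    guarantee that nodes in the polygon come from [points Q]. *)
Lemma count_residue (Hs : seq (half_plane R)) (Q M u v : nat) (x0 y0 s : R) :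
  (0 < Q)%N -> (u < M)%N -> (v < M)%N -> 0 <= x0 -> 0 <= y0 -> 0 <= s ->
  (forall z, in_polygon Hs z -> [/\ x0 <= z.1 <= x0 + s, y0 <= z.2 <= y0 + s,
     0 < z.1 <= 1 & 0 < z.2 <= 1]) ->
  area [set z | in_polygon Hs z] = (polygon_area Hs)%:E /\
  `|(count (fun t => in_polygon Hs (scaled Q t) &&
      ((t.1 == u %[mod M]) && (t.2 == v %[mod M]))) (points Q))%:R
     - polygon_area Hs * Q%:R ^+ 2 / M%:R ^+ 2|
   <= 5 * (size Hs)%:R * (s * Q%:R / M%:R + 2).
Proof.
move=> Q0 uM vM x00 y00 s0 box.
have M0 : (0 < M)%N by apply: leq_ltn_trans uM.
have QR : 0 < Q%:R :> R by rewrite ltr0n.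
have MR : 0 < M%:R :> R by rewrite ltr0n.
pose h : R := M%:R / Q%:R; have h0 : 0 < h by rewrite divr_gt0.
have hQ : h * Q%:R = M%:R by rewrite /h divfK // gt_eqF.
have start (c : nat) (x : R) : (c < M)%N -> 0 <= x ->
    exists i : nat, x <= (c + M * i)%:R / Q%:R /\ (c + M * i)%:R / Q%:R - h < x.
  move=> cM xge; have [i [i1 i2]] := minimal_above ((x * Q%:R - c%:R) / M%:R).
  rewrite ler_pdivrMr // in i1.
  have E : (c + M * i)%:R / Q%:R = c%:R / Q%:R + h * i%:R :> R.
    by rewrite natrD natrM /h; field; rewrite gt_eqF.
  exists i; split; first by rewrite ler_pdivlMr // natrD natrM; lra.
  rewrite E; case: i2 => [->|].
    rewrite mulr0 addr0; apply: lt_le_trans xge; rewrite subr_lt0 /h.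
    by rewrite ltr_pM2r ?invr_gt0 // ltr_nat.
  rewrite ltr_pdivlMr // => i2.
  rewrite -(ltr_pM2r QR) (_ : (_ + _ - _) * _ = c%:R + (i%:R - 1) * M%:R); first lra.
  by rewrite /h; field; rewrite gt_eqF.
(* In each coordinate the first member of the class at or beyond the corner of the box becomes the
   origin of the grid. *)
have [i0 [i01 i02]] := start u x0 uM x00.
have [j0 [j01 j02]] := start v y0 vM y00.
pose a : R := (u + M * i0)%:R / Q%:R; pose b : R := (v + M * j0)%:R / Q%:R.
rewrite -/a in i01 i02; rewrite -/b in j01 j02.
(* The last node, a + h (n - 1), must lie beyond a + s; still n <= s / h + 2 = s Q / M + 2. *)
pose n := (Num.truncn (s / h)).+2.
have sh0 : 0 <= s / h by rewrite divr_ge0 // ltW.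
have n1 : s < h * (n%:R - 1).
  by rewrite mulrC -ltr_pdivrMr // /n -natr1 addrK truncnS_gt.
have n2 : n%:R <= s / h + 2.
  by rewrite /n -[_.+2%:R]natr1 -natr1 -addrA lerD2r truncn_le.
have cover z : in_polygon Hs z -> cells a b h (grid n) z.
  move=> /box[/andP[x1 x2] /andP[y1 y2] _ _].
  have [i i1 i2] := @cell_index a h z.1 s n h0 (lt_le_trans i02 x1) ltac:(lra) n1.
  have [j j1 j2] := @cell_index b h z.2 s n h0 (lt_le_trans j02 y1) ltac:(lra) n1.
  exists (i, j); first by rewrite mem_grid i1 j1.
  by split; rewrite /= in_itv.
have [A PA err] := area_polygon_count h0 cover.
have AE : polygon_area Hs = A by rewrite /polygon_area PA.
split; first by rewrite AE.
rewrite AE.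
pose f (t : nat * nat) := (u + M * (i0 + t.1), v + M * (j0 + t.2))%N.
have nodeE t : node a b h t = scaled Q (f t).
  rewrite /node /scaled /a /b /h /f /= !natrD !natrM !natrD.
  by congr pair; field; rewrite gt_eqF.
rewrite -(count_bij (f := f) (s1 := grid n) (P1 := fun t => in_polygon Hs (node a b h t))).
- move: err; set c := (count _ _)%:R => err.
  have h2 : 0 < h ^+ 2 by rewrite exprn_gt0.
  rewrite -(ler_pM2r h2) -[X in _ * X <= _](gtr0_norm h2) -normrM mulrBl.
  rewrite (_ : A * _ / _ * _ = A); last by rewrite /h; field; rewrite !gt_eqF.
  apply: (le_trans err); rewrite ler_pM2r // natrM natrM mulrCA mulrA.
  rewrite ler_wpM2l ?mulr_ge0 //.
  by rewrite (_ : s * _ / _ = s / h) // /h; field; rewrite !gt_eqF.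
- exact: grid_uniq.
- exact: points_uniq.
- move=> [i j] [i' j'] _ _ [] /eqP; rewrite eqn_add2l eqn_pmul2l // eqn_add2l => /eqP->.
  by move=> /eqP; rewrite eqn_add2l eqn_pmul2l // eqn_add2l => /eqP->.
- move=> t _; rewrite nodeE => Pt; have [_ _] := box _ Pt.
  rewrite Pt mem_points !natr_div_itv // => -> ->.
  by rewrite /f /= ![(_ + M * _)%N]addnC ![(M * _)%N]mulnC !modnMDl !eqxx.
move=> t tp /andP[Pt /andP[/eqP t1 /eqP t2]].
have [[i j]] := cover _ Pt; rewrite mem_grid /= => /andP[ilt jlt] [/=].
rewrite !in_itv /= => ci cj.
have e1 : t.1 = (u + M * (t.1 %/ M))%N.
  by rewrite [LHS](divn_eq _ M) t1 modn_small // mulnC addnC.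
have e2 : t.2 = (v + M * (t.2 %/ M))%N.
  by rewrite [LHS](divn_eq _ M) t2 modn_small // mulnC addnC.
have coord (w k k0 l x : nat) : x = (w + M * k)%N ->
    (w + M * k0)%:R / Q%:R + h * l%:R - h < x%:R / Q%:R <= (w + M * k0)%:R / Q%:R + h * l%:R ->
    (k0 + l = k)%N.
  move=> -> hh; apply: (@mem_cell_coord R h h0 (w%:R / Q%:R) ((w + M * k)%:R / Q%:R)).
    move: hh; rewrite (_ : (w + M * k0)%:R / Q%:R + _ = w%:R / Q%:R + h * (k0 + l)%:R) //.
    by rewrite !natrD natrM /h; field; rewrite gt_eqF.
  rewrite (_ : (w + M * k)%:R / Q%:R = w%:R / Q%:R + h * k%:R); first by rewrite lexx; lra.
  by rewrite !natrD natrM /h; field; rewrite gt_eqF.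
exists (i, j); split; first by rewrite mem_grid ilt jlt.
- rewrite nodeE /f /= (coord _ _ _ _ _ e1 ci) (coord _ _ _ _ _ e2 cj) -e1 -e2.
  by case: (t) Pt.
- by rewrite /f /= (coord _ _ _ _ _ e1 ci) (coord _ _ _ _ _ e2 cj) -e1 -e2; case: (t).
Qed.

Lemma count_coprime_mobius (P : pred (nat * nat)) Q :
  (count (fun t => P t && coprime t.1 t.2) (points Q))%:R =
  \sum_(m <- iota 1 Q) mobius R m *
    (count (fun t => P t && ((m %| t.1)%N && (m %| t.2)%N)) (points Q))%:R.
Proof.
under [RHS]eq_bigr do rewrite natr_count mulr_sumr.
rewrite exchange_big natr_count /= !big_seq; apply: eq_bigr => t.
rewrite mem_points => /andP[/andP[t1 t1Q] /andP[t2 t2Q]].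
have g0 : (0 < gcdn t.1 t.2 <= Q)%N.
  by rewrite gcdn_gt0 t1 (leq_trans (dvdn_leq t1 (dvdn_gcdl _ _))).
case: (P t) => /=; last by rewrite big1 // => m _; rewrite mulr0.
rewrite /coprime -(sum_mobius_dvd _ g0) [LHS]big_mkcond; apply: eq_bigr => m _.
by rewrite dvdn_gcd; case: andP => _; rewrite ?mulr1 ?mulr0.
Qed.

Definition residue_count (Hs : seq (half_plane R)) Q d u v m : nat :=
  count (fun t => (in_polygon Hs (scaled Q t) &&
      ((t.1 == u %[mod d]) && (t.2 == v %[mod d]))) && ((m %| t.1)%N && (m %| t.2)%N))
    (points Q).

(** By the Chinese remainder theorem the two conditions form one class modulo m d. In the error, d
    is discarded in favour of the weaker s Q / m, which makes the bound uniform in d. *)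
Lemma residue_count_coprime (Hs : seq (half_plane R)) Q d u v m (x0 y0 s : R) :
  (0 < Q)%N -> (0 < d)%N -> (0 < m)%N -> coprime m d -> 0 <= x0 -> 0 <= y0 -> 0 <= s ->
  (forall z, in_polygon Hs z -> [/\ x0 <= z.1 <= x0 + s, y0 <= z.2 <= y0 + s,
     0 < z.1 <= 1 & 0 < z.2 <= 1]) ->
  `|(residue_count Hs Q d u v m)%:R - polygon_area Hs * Q%:R ^+ 2 / (m * d)%:R ^+ 2|
   <= 5 * (size Hs)%:R * (s * Q%:R / m%:R + 2).
Proof.
move=> Q0 d0 m0 cmd x00 y00 s0 box.
have md0 : (0 < m * d)%N by rewrite muln_gt0 m0.
pose u' := (chinese m d 0 u %% (m * d))%N; pose v' := (chinese m d 0 v %% (m * d))%N.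
have crt w x : (x == chinese m d 0 w %% (m * d) %[mod m * d])%N =
    (m %| x)%N && (x == w %[mod d])%N.
  rewrite modn_mod chinese_remainder // chinese_modl // chinese_modr // mod0n.
  by rewrite /dvdn.
have [_] := count_residue Q0 (ltn_pmod _ md0 : (u' < _)%N) (ltn_pmod _ md0 : (v' < _)%N) x00 y00 s0 box.
rewrite (eq_count (a2 := fun t => (in_polygon Hs (scaled Q t) &&
      ((t.1 == u %[mod d]) && (t.2 == v %[mod d]))) && ((m %| t.1)%N && (m %| t.2)%N))).
  move=> /le_trans; apply; rewrite ler_wpM2l ?mulr_ge0 // lerD2r.
  rewrite -!mulrA ler_wpM2l // ler_wpM2l //.
  by rewrite lef_pV2 ?posrE ?ltr0n // ler_nat leq_pmulr.
move=> t; rewrite /= !crt; case: (in_polygon _ _) => //=.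
by case: (m %| t.1)%N; case: (m %| t.2)%N; rewrite /= ?andbT ?andbF.
Qed.

(** Moebius inversion over m <= Q; the errors E Q / m add up to the factor 1 + ln Q. If m shares a
    factor with d, that factor divides every point counted, hence u and v, against the coprimality
    assumption; such m contribute nothing. *)
Lemma coprime_residue_count (Hs : seq (half_plane R)) Q d u v (E : R) :
  (0 < Q)%N -> (0 < d)%N -> coprime (gcdn u v) d ->
  (forall m, (0 < m <= Q)%N -> coprime m d ->
    `|(residue_count Hs Q d u v m)%:R - polygon_area Hs * Q%:R ^+ 2 / (m * d)%:R ^+ 2|
      <= E * Q%:R / m%:R) ->
  `|(count (fun t => (in_polygon Hs (scaled Q t) &&
      ((t.1 == u %[mod d]) && (t.2 == v %[mod d]))) && coprime t.1 t.2) (points Q))%:R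
    - polygon_area Hs * Q%:R ^+ 2 / d%:R ^+ 2 * mobius_sum R d Q|
  <= E * Q%:R * (1 + ln Q%:R).
Proof.
move=> Q0 d0 cuv H; rewrite count_coprime_mobius.
have QR : 0 < Q%:R :> R by rewrite ltr0n.
have dR : 0 < d%:R :> R by rewrite ltr0n.
have E0 : 0 <= E.
  have := H 1%N; rewrite Q0 coprime1n => /(_ isT isT) /(le_trans (normr_ge0 _)).
  by rewrite divr1 pmulr_lge0.
rewrite /mobius_sum mulr_sumr [X in _ - X]big_mkcond -sumrB.
apply: (le_trans (ler_norm_sum _ _ _)).
apply: (@le_trans _ _ (\sum_(m <- iota 1 Q) E * Q%:R * m%:R^-1)); last first.
  rewrite -mulr_sumr ler_wpM2l ?mulr_ge0 //; exact: sum_inv_le_ln.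
rewrite !big_seq; apply: ler_sum => m; rewrite mem_iota add1n ltnS => mQ.
have m0 : (0 < m)%N by case/andP: mQ.
have mR : 0 < m%:R :> R by rewrite ltr0n.
case: ifPn => cmd.
  rewrite (_ : _ - _ = mobius R m * ((residue_count Hs Q d u v m)%:R
      - polygon_area Hs * Q%:R ^+ 2 / (m * d)%:R ^+ 2)); last first.
    rewrite /residue_count mulrBr; congr (_ - _); rewrite natrM; field.
    by rewrite !gt_eqF.
  rewrite normrM; apply: le_trans (H _ mQ cmd); rewrite ler_piMl //; exact: mobius_norm.
rewrite subr0 (eq_count (a2 := pred0)) ?count_pred0 ?mulr0 ?normr0.
  by rewrite !mulr_ge0 ?invr_ge0.
move=> t; apply/negbTE/negP => /andP[/andP[_ /andP[t1 t2]] /andP[m1 m2]].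
pose g := gcdn m d.
have res x w : (m %| x)%N -> x == w %[mod d] -> (g %| w)%N.
  move=> mx xw; have gx : (g %| x)%N := dvdn_trans (dvdn_gcdl _ _) mx.
  have gd : (g %| d)%N := dvdn_gcdr _ _.
  rewrite (divn_eq w d) dvdn_addr ?dvdn_mull // -(eqP xw).
  by move: gx; rewrite {1}(divn_eq x d) dvdn_addr ?dvdn_mull.
have : (g %| gcdn (gcdn u v) d)%N.
  by rewrite !dvdn_gcd (res _ _ m1 t1) (res _ _ m2 t2) dvdn_gcdr.
by rewrite (eqP cuv) dvdn1; apply/negP.
Qed.

End LatticePoints.

(** * Dynamics of lattice points *)

Section Dynamics.
Local Open Scope nat_scope.

(** [lattice_point] without coprimality: the Farey step permutes all these points, and areas are
    read off from counts of all of them. *)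
Definition in_triangle (Q : nat) (p : nat * nat) : bool :=
  [&& 0 < p.1 <= Q, 0 < p.2 <= Q & Q < p.1 + p.2].

Lemma lattice_pointE Q p : lattice_point Q p = in_triangle Q p && coprime p.1 p.2.
Proof. by rewrite /lattice_point /in_triangle -!andbA. Qed.

Lemma in_triangle_points Q p : in_triangle Q p -> p \in points Q.
Proof. by rewrite mem_points => /and3P[-> ->]. Qed.

Lemma index_natP Q p : in_triangle Q p ->
  Q + p.1 < (index_nat Q p).+1 * p.2 /\ index_nat Q p * p.2 <= Q + p.1.
Proof.
move=> /and3P[p1 p2 p12]; rewrite /index_nat.
by split; [rewrite -ltn_divLR //; lia | exact: leq_divM].
Qed.

Lemma index_nat_gt0 Q p : in_triangle Q p -> 0 < index_nat Q p.
Proof. by move=> D; have := index_natP D; move/and3P: D => [? ? ?]; nia. Qed.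

Lemma next_natE Q p : in_triangle Q p ->
  (next_nat Q p).2 + p.1 = index_nat Q p * p.2.
Proof.
by move=> D; rewrite /next_nat /=; have := index_natP D; move/and3P: D => [? ? ?]; nia.
Qed.

Lemma next_nat_triangle Q p : in_triangle Q p -> in_triangle Q (next_nat Q p).
Proof.
move=> D; have := next_natE D; have := index_natP D; move/and3P: D => [? ? ?].
by rewrite /in_triangle /=; set x := _ - _; nia.
Qed.

(** The image gives [p.2] and the residue of [p.1] modulo [p.2], and [p.1] lies in the interval from
    Q - p.2 (excluded) to Q, of length [p.2]. *)
Lemma next_nat_inj Q : {in in_triangle Q &, injective (next_nat Q)}.
Proof.
move=> p p' D D' E; have := next_natE D; have := next_natE D'.
have e2 : p.2 = p'.2 by case: E.
rewrite E -e2; move/and3P: D' D E => [a1 a2 a3] /and3P[b1 b2 b3] _.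
move: (index_nat Q p) (index_nat Q p') (next_nat Q p').2 => k k' x E' E.
have e1 : p.1 = p'.1.
  rewrite -e2 in a2 a3; have : p.1 + k' * p.2 = p'.1 + k * p.2 by lia.
  have [kk|kk|->] := ltngtP k k'; last by lia.
  - have : k' * p.2 >= k * p.2 + p.2 by nia.
    lia.
  - have : k * p.2 >= k' * p.2 + p.2 by nia.
    lia.
by case: p p' e1 e2 {a1 a2 a3 b1 b2 b3 E E'} => [? ?] [? ?] /= -> ->.
Qed.

Lemma coprime_next_nat Q p : in_triangle Q p ->
  coprime (next_nat Q p).1 (next_nat Q p).2 = coprime p.1 p.2.
Proof.
move=> D; have := next_natE D; rewrite /next_nat /=; set x := _ - _ => E.
suff gE : gcdn p.2 x = gcdn p.1 p.2 by rewrite /coprime gE.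
have d2 g : g %| p.2 -> g %| x + p.1 by move=> g2; rewrite E dvdn_mull.
apply/eqP; rewrite eqn_dvd !dvdn_gcd dvdn_gcdr dvdn_gcdl /=; apply/andP; split.
  by rewrite andbT -(dvdn_addr _ (dvdn_gcdr _ x)) d2 ?dvdn_gcdl.
by rewrite -(dvdn_addl _ (dvdn_gcdl p.1 _)) d2 ?dvdn_gcdr.
Qed.

Lemma q_pair_triangle Q p j : in_triangle Q p -> in_triangle Q (q_pair Q p j).
Proof. by move=> D; elim: j => //= j; exact: next_nat_triangle. Qed.

Lemma coprime_q_pair Q p j : in_triangle Q p ->
  coprime (q_pair Q p j).1 (q_pair Q p j).2 = coprime p.1 p.2.
Proof.
by move=> D; elim: j => //= j <-; rewrite coprime_next_nat //; exact: q_pair_triangle.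
Qed.

Lemma q_pair2 Q p j : (q_pair Q p j).2 = (q_pair Q p j.+1).1.
Proof. by []. Qed.

Definition triangle_points Q := [seq p <- points Q | in_triangle Q p].

Lemma mem_triangle_points Q p : (p \in triangle_points Q) = in_triangle Q p.
Proof.
by rewrite mem_filter andbC; apply/andP/idP => [[]//|D]; rewrite in_triangle_points.
Qed.

Lemma triangle_points_uniq Q : uniq (triangle_points Q).
Proof. exact: filter_uniq (points_uniq Q). Qed.

Lemma count_triangle Q (P : pred (nat * nat)) :
  count (fun p => in_triangle Q p && P p) (points Q) = count P (triangle_points Q).
Proof. by rewrite count_filter; apply: eq_count => p /=; rewrite andbC. Qed.

(** An injective map of a finite set into itself permutes it. This is the discrete form of area
    invariance. *)
Lemma count_next_nat Q (P : pred (nat * nat)) :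
  count (fun p => P (next_nat Q p)) (triangle_points Q) = count P (triangle_points Q).
Proof.
rewrite -(count_map (next_nat Q) P); apply/permP; apply: uniq_perm.
- rewrite map_inj_in_uniq ?triangle_points_uniq // => p p'; rewrite !mem_triangle_points.
  exact: next_nat_inj.
- exact: triangle_points_uniq.
apply: (uniq_min_size _ _ _).2.
- rewrite map_inj_in_uniq ?triangle_points_uniq // => p p'; rewrite !mem_triangle_points.
  exact: next_nat_inj.
- move=> x /mapP[p]; rewrite !mem_triangle_points => D ->; exact: next_nat_triangle.
by rewrite size_map.
Qed.

Lemma count_q_pair Q (P : pred (nat * nat)) j :
  count (fun p => P (q_pair Q p j)) (triangle_points Q) = count P (triangle_points Q).
Proof.
elim: j P => [|j IH] P //; rewrite -(count_next_nat Q P) -(IH (fun p => P (next_nat Q p))).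
by [].
Qed.

Definition k_seq s Q p : seq nat := mkseq (fun i => index_nat Q (q_pair Q p i)) s.

Lemma val_k_vec s Q p : val (k_vec s Q p) = k_seq s Q p.
Proof.
apply: (@eq_from_nth _ 0); first by rewrite size_mkseq size_tuple.
move=> i; rewrite size_tuple => lt; rewrite nth_mkseq //.
by rewrite -[i]/(val (Ordinal lt)) -tnth_nth tnth_mktuple.
Qed.

Lemma q_pair_rec Q p j : in_triangle Q p ->
  (q_pair Q p j.+2).1 + (q_pair Q p j).1 =
  index_nat Q (q_pair Q p j) * (q_pair Q p j.+1).1.
Proof. by move=> D; exact: next_natE (q_pair_triangle j D). Qed.

(* After a small denominator y the denominators decrease by y at each step. *)
Lemma indices_after_small Q (q k : nat -> nat) N :
  (forall i, i <= N.+1 -> 0 < q i <= Q) ->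
  (forall i, i <= N -> Q < q i + q i.+1) ->
  (forall i, i < N -> q i.+2 + q i = k i * q i.+1) ->
  (2 * N + 5) * q 0 < Q ->
  forall i, i < N -> k i = if i == 0 then 1 else 2.
Proof.
move=> q1 q2 rec small.
have inv i : 0 < i <= N -> q i.+1 + q 0 = q i /\ Q < q i + i * q 0.
  elim: i => // -[_ H|i IH H].
    have := rec 0 ltac:(lia); have := q2 0 ltac:(lia); have := q2 1 ltac:(lia).
    have := q1 0 ltac:(lia); have := q1 1 ltac:(lia); have := q1 2 ltac:(lia).
    move: (q 0) (q 1) (q 2) (k 0) small => a b c e small *.
    have : e = 1 by nia.
    by move=> e1; subst e; lia.
  have [I1 I2] := IH ltac:(lia).
  have := rec i.+1 ltac:(lia); have := q2 i.+2 ltac:(lia).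
  have := q1 0 ltac:(lia); have := q1 i.+1 ltac:(lia); have := q1 i.+2 ltac:(lia).
  have := q1 i.+3 ltac:(lia).
  (* Origin of the factor 2 N + 5: by the invariant, an index of 3 or more at this step would force
     Q < (2 i + 5) q_0. *)
  have : (2 * i.+1 + 3) * q 0 < Q by nia.
  move: (q 0) (q i.+1) (q i.+2) (q i.+3) (k i.+1) I1 I2 => a b c d e I1 I2 *.
  have e2 : e = 2 by nia.
  by subst e; nia.
move=> [|i] H /=.
  have := rec 0 ltac:(lia); have := q2 0 ltac:(lia); have := q2 1 ltac:(lia).
  have := q1 0 ltac:(lia); have := q1 1 ltac:(lia); have := q1 2 ltac:(lia).
  move: (q 0) (q 1) (q 2) (k 0) small => a b c e small *.
  nia.
have [I1 I2] := inv i.+1 ltac:(lia).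
have [I3 I4] := inv i.+2 ltac:(lia).
have := rec i.+1 ltac:(lia).
have := q1 i.+2 ltac:(lia); have := q1 0 ltac:(lia).
by move: (q i.+1) (q i.+2) (q i.+3) (q 0) (k i.+1) I1 I2 I3 I4 => a b c d e *; nia.
Qed.

(** A large index at position j means that the denominator q_(j+1) it multiplies is small. The
    preceding lemma applies from there forwards, and also backwards because the recurrence q_(i+2) +
    q_i = k q_(i+1) is invariant under reversal. *)
Lemma k_large_pattern Q p s j : in_triangle Q p -> j < s ->
  10 * s + 10 < index_nat Q (q_pair Q p j) ->
  forall i, i < s -> i != j -> index_nat Q (q_pair Q p i) =
    if (i.+1 == j) || (i == j.+1) then 1 else 2.
Proof.
move=> D js large.
(* An index K satisfies K q_(j+1) <= 2 Q, so K > 10 s + 10 gives this. The factor 5 s + 5 exceeds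
   the required 2 N + 5 in both directions, where N is at most s. *)
have small : (5 * s + 5) * (q_pair Q p j.+1).1 < Q.
  have [_] := index_natP (q_pair_triangle j D).
  by have /and3P[] := q_pair_triangle j D; rewrite q_pair2; nia.
have qQ i : 0 < (q_pair Q p i).1 <= Q by have /and3P[] := q_pair_triangle i D.
have qq i : Q < (q_pair Q p i).1 + (q_pair Q p i.+1).1.
  by have /and3P[] := q_pair_triangle i D.
move=> i is_ /eqP ij; have [lt|le] := ltnP j i.
  have H : forall n, n < s - j.+1 ->
      index_nat Q (q_pair Q p (j.+1 + n)) = if n == 0 then 1 else 2.
    apply: (@indices_after_small Q (fun n => (q_pair Q p (j.+1 + n)).1)).
    - by move=> n _; exact: qQ.
    - by move=> n _; rewrite addnS; exact: qq.
    - by move=> n _; rewrite !addnS; exact: q_pair_rec.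
    - by rewrite addn0; nia.
  have := H (i - j.+1) ltac:(lia); rewrite subnKC // => ->.
  rewrite (_ : (i.+1 == j) = false) /=; last by lia.
  by rewrite (_ : (i - j.+1 == 0) = (i == j.+1)) //; lia.
have lt : i < j by lia.
have H : forall n, n < j ->
    index_nat Q (q_pair Q p (j.-1 - n)) = if n == 0 then 1 else 2.
  apply: (@indices_after_small Q (fun n => (q_pair Q p (j.+1 - n)).1)).
  - by move=> n _; exact: qQ.
  - move=> n nj; rewrite subSS addnC; have := qq (j - n).
    by rewrite (_ : (j - n).+1 = j.+1 - n) //; lia.
  - move=> n nj; have := q_pair_rec (j.-1 - n) D.
    rewrite (_ : (j.-1 - n).+2 = j.+1 - n); last by lia.
    rewrite (_ : (j.-1 - n).+1 = j.+1 - n.+1); last by lia.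
    by rewrite addnC (_ : j.+1 - n.+2 = j.-1 - n) //; lia.
  - by rewrite subn0; nia.
have := H (j.-1 - i) ltac:(lia).
rewrite (_ : j.-1 - (j.-1 - i) = i); last by lia.
move=> ->; rewrite (_ : (i == j.+1) = false) ?orbF; last by lia.
by rewrite (_ : (j.-1 - i == 0) = (i.+1 == j)) //; lia.
Qed.

(** A large value at a given position thus belongs to a single vector, which turns the sum over
    vectors with a large entry into sums over one integer K. *)
Lemma k_large_unique Q Q' p p' s j : in_triangle Q p -> in_triangle Q' p' -> j < s ->
  10 * s + 10 < nth 0 (k_seq s Q p) j ->
  nth 0 (k_seq s Q p) j = nth 0 (k_seq s Q' p') j ->
  k_seq s Q p = k_seq s Q' p'.
Proof.
move=> D D' js; rewrite !nth_mkseq // => large E.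
apply: (@eq_from_nth _ 0); rewrite ?size_mkseq // => i is_; rewrite !nth_mkseq //.
have [->//|ij] := eqVneq i j.
by rewrite (k_large_pattern D js large) // (k_large_pattern D' js) // -E.
Qed.

(** Both outer terms of q_(i+2) + q_i = k q_(i+1) have coefficient 1, so two neighbouring residues
    at any position j propagate in both directions, modulo any d. *)
Lemma q_pair_congr Q Q' p p' s d j : in_triangle Q p -> in_triangle Q' p' ->
  k_seq s Q p = k_seq s Q' p' -> j <= s ->
  (q_pair Q p j).1 = (q_pair Q' p' j).1 %[mod d] ->
  (q_pair Q p j.+1).1 = (q_pair Q' p' j.+1).1 %[mod d] ->
  forall i, i < s.+2 -> (q_pair Q p i).1 = (q_pair Q' p' i).1 %[mod d].
Proof.
move=> D D' Ek js e1 e2.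
have kE i : i < s -> index_nat Q (q_pair Q p i) = index_nat Q' (q_pair Q' p' i).
  by move=> is_; have := congr1 (nth 0 ^~ i) Ek; rewrite !nth_mkseq.
have fwd n : j + n <= s -> (q_pair Q p (j + n)).1 = (q_pair Q' p' (j + n)).1 %[mod d] /\
    (q_pair Q p (j + n).+1).1 = (q_pair Q' p' (j + n).+1).1 %[mod d].
  elim: n => [|n IH] H; first by rewrite addn0.
  rewrite addnS in H *; have [I1 I2] := IH (ltnW H); split=> //.
  apply/eqP; rewrite -(eqn_modDr (q_pair Q p (j + n)).1) q_pair_rec // kE //.
  rewrite -modnMmr I2 modnMmr -q_pair_rec //.
  by rewrite -modnDmr -I1 modnDmr.
have bwd n : n <= j -> (q_pair Q p (j - n)).1 = (q_pair Q' p' (j - n)).1 %[mod d] /\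
    (q_pair Q p (j - n).+1).1 = (q_pair Q' p' (j - n).+1).1 %[mod d].
  elim: n => [|n IH] H; first by rewrite subn0.
  have lt : j - n.+1 < s by move: H js; clear; lia.
  have E : j - n = (j - n.+1).+1 by move: H; clear; lia.
  have [] := IH (ltnW H); rewrite E => I1 I2; split=> //.
  apply/eqP; rewrite -(eqn_modDl (q_pair Q p (j - n.+1).+2).1) q_pair_rec // kE //.
  rewrite -modnMmr I1 modnMmr -q_pair_rec //.
  by rewrite -modnDml -I2 modnDml.
move=> i is_; have [ij|ji] := leqP i j.
  by have [] := bwd (j - i) (leq_subr _ _); rewrite subKn.
case: i is_ ji => // i; rewrite !ltnS => is_ ji.
by have [] := fwd (i - j); rewrite subnKC.
Qed.

End Dynamics.

(** * Index regions *)

Section Regions.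
Variable R : realType.
Implicit Types (z : R * R) (f g : R * R).

Definition linear_form f z : R := f.1 * z.1 + f.2 * z.2.

(* For consecutive forms f, g and the next one e = k g - f, the index is k
   exactly when the pair (g, e) stays in the triangle: e <= 1 and g + e > 1. *)
Fixpoint index_planes f g (ks : seq nat) : seq (half_plane R) :=
  if ks is k :: ks' then
    let e := (k%:R * g.1 - f.1, k%:R * g.2 - f.2) in
    (e, (1, false)) :: ((- g.1 - e.1, - g.2 - e.2), (-1, true)) :: index_planes g e ks'
  else [::].

Definition triangle_planes : seq (half_plane R) :=
  [:: ((-1, 0), (0, true)); ((1, 0), (1, false));
      ((0, -1), (0, true)); ((0, 1), (1, false)); ((-1, -1), (-1, true))].

Definition region_planes (ks : seq nat) :=
  triangle_planes ++ index_planes (1, 0) (0, 1) ks.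

Lemma size_region_planes ks : size (region_planes ks) = (5 + 2 * size ks)%N.
Proof.
rewrite size_cat /=; congr (5 + _)%N.
by elim: ks (1, 0) (0, 1) => //= k ks IH f g; rewrite IH; lia.
Qed.

Lemma in_triangle_planes z : in_polygon triangle_planes z <-> farey_triangle z.
Proof.
rewrite /in_polygon /in_half_plane /farey_triangle /=; split.
  move=> /and5P[h1 h2 h3 h4 /andP[h5 _]].
  by split; try (apply/andP; split); lra.
move=> [/andP[h1 h2] /andP[h3 h4] h5].
by apply/and5P; split; try (apply/andP; split); lra.
Qed.

Lemma index_realP z (k : nat) : farey_triangle z -> index_real z = k%:Z <->
  k%:R * z.2 - z.1 <= 1 /\ z.2 + (k%:R * z.2 - z.1) > 1.
Proof.
move=> [/andP[h1 h2] /andP[h3 h4] h5]; rewrite /index_real.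
split => [/eqP|[k1 k2]]; last apply/eqP;
  rewrite floor_eq intrD -pmulrn ler_pdivlMr // ltr_pdivrMr // mulrDl mul1r.
  by move=> /andP[k1 k2]; split; lra.
by apply/andP; split; lra.
Qed.

Lemma next_real_triangle z : farey_triangle z -> farey_triangle (next_real z).
Proof.
move=> T; case: (T) => [/andP[h1 h2] /andP[h3 h4] h5]; rewrite /next_real /index_real.
have := floor_itv ((1 + z.1) / z.2); rewrite ler_pdivlMr // ltr_pdivrMr // intrD.
move: (_%:~R) => k /andP[k1 k2]; rewrite mulrDl mul1r in k2.
by split=> /=; try (apply/andP; split); lra.
Qed.

Lemma in_index_planes f g ks z : farey_triangle (linear_form f z, linear_form g z) ->
  in_polygon (index_planes f g ks) z <->
  forall i, (i < size ks)%N ->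
    index_real (iter i (@next_real R) (linear_form f z, linear_form g z)) = (nth 0%N ks i)%:Z.
Proof.
elim: ks f g => [|k ks IH] f g T; first by split.
pose e : R * R := (k%:R * g.1 - f.1, k%:R * g.2 - f.2).
have eE : linear_form e z = k%:R * linear_form g z - linear_form f z.
  by rewrite /linear_form /e /=; ring.
have nextE : index_real (linear_form f z, linear_form g z) = k%:Z ->
    next_real (linear_form f z, linear_form g z) = (linear_form g z, linear_form e z).
  by move=> kE; rewrite /next_real kE eE -pmulrn.
have head : in_half_plane (e, (1, false)) z /\
    in_half_plane ((- g.1 - e.1, - g.2 - e.2), (-1, true)) z <->
    index_real (linear_form f z, linear_form g z) = k%:Z.
  rewrite index_realP //= -eE /in_half_plane /=.
  rewrite (_ : (- g.1 - e.1) * z.1 + (- g.2 - e.2) * z.2 = - (linear_form g z + linear_form e z));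
    last by rewrite /linear_form; ring.
  by rewrite ltrN2.
split.
  rewrite /in_polygon /= -/e => /and3P[h1 h2 h3].
  have kE := head.1 (conj h1 h2).
  have := next_real_triangle T; rewrite nextE // => T'.
  move=> [|i] //=; rewrite ltnS -iterS iterSr nextE // => ilt.
  by move: ilt; apply: (IH g e T').1.
move=> H; have kE : index_real (linear_form f z, linear_form g z) = k%:Z by exact: (H 0%N).
have := next_real_triangle T; rewrite nextE // => T'.
have [h1 h2] := head.2 kE.
rewrite /in_polygon /= -/e h1 h2 /=; apply: (IH g e T').2 => i ilt.
by have := H i.+1 ilt; rewrite iterSr nextE.
Qed.

Lemma in_region_planes ks z : in_polygon (region_planes ks) z <->
  farey_triangle z /\
  forall i, (i < size ks)%N -> index_real (L_pair z i) = (nth 0%N ks i)%:Z.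
Proof.
rewrite /in_polygon /region_planes all_cat -(rwP andP) -/(in_polygon _ _) in_triangle_planes.
have E : (linear_form (1, 0) z, linear_form (0, 1) z) = z.
  by rewrite /linear_form /= !mul1r !mul0r addr0 add0r; case: z.
have := @in_index_planes (1, 0) (0, 1) ks z; rewrite E => H.
by split=> -[T h]; split => //; apply/(H T).
Qed.

Lemma T_regionE s (k : s.-tuple nat) :
  @T_region R s k = [set z | in_polygon (region_planes k) z].
Proof.
apply/seteqP; split => z /=; rewrite in_region_planes => -[T H]; split => // i.
  by rewrite size_tuple => lt; have := H (Ordinal lt); rewrite (tnth_nth 0%N).
by have := H i; rewrite size_tuple ltn_ord => /(_ isT) ->; rewrite (tnth_nth 0%N).
Qed.

Lemma region_box ks z : in_polygon (region_planes ks) z ->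
  [/\ 0 <= z.1 <= 0 + 1, 0 <= z.2 <= 0 + 1, 0 < z.1 <= 1 & 0 < z.2 <= 1].
Proof.
move=> /in_region_planes[[/andP[h1 h2] /andP[h3 h4] h5] _].
by split; apply/andP; split; lra.
Qed.

(** Index K gives K y <= 1 + x <= 2, and then x > 1 - y: the region sits in the corner (1, 0). *)
Lemma region_box1 K z : (0 < K)%N -> in_polygon (region_planes [:: K]) z ->
  [/\ 1 - 2 / K%:R <= z.1 <= 1 - 2 / K%:R + 2 / K%:R, 0 <= z.2 <= 0 + 2 / K%:R,
     0 < z.1 <= 1 & 0 < z.2 <= 1].
Proof.
move=> K0 /in_region_planes[T /(_ 0%N isT) /(index_realP _ T)[k1 k2]].
have KR : 0 < K%:R :> R by rewrite ltr0n.
case: T => /andP[h1 h2] /andP[h3 h4] h5.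
have y : z.2 <= 2 / K%:R by rewrite ler_pdivlMr //= in k1 *; lra.
by split; apply/andP; split; lra.
Qed.

Lemma farey_triangle_scaled Q p : (0 < Q)%N ->
  farey_triangle (scaled R Q p) <-> in_triangle Q p.
Proof.
move=> Q0; have QR : 0 < Q%:R :> R by rewrite ltr0n.
have E : (p.1%:R / Q%:R + p.2%:R / Q%:R > 1 :> R) = (Q < p.1 + p.2)%N.
  by rewrite -mulrDl ltr_pdivlMr // mul1r -natrD ltr_nat.
rewrite /farey_triangle /in_triangle /scaled /= !natr_div_itv // E.
by split=> [[-> -> ->]|/and3P[]].
Qed.

Lemma index_real_scaled Q p : (0 < Q)%N -> in_triangle Q p ->
  index_real (scaled R Q p) = (index_nat Q p)%:Z.
Proof.
move=> Q0 D; have QR : 0 < Q%:R :> R by rewrite ltr0n.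
apply/index_realP; first exact/farey_triangle_scaled.
have := next_natE D; have /and3P[_ n2] := next_nat_triangle D; rewrite [(next_nat _ _).1]/=.
move: (next_nat Q p).2 n2 => x /andP[_ xQ] xp E.
have -> : (index_nat Q p)%:R * (scaled R Q p).2 - (scaled R Q p).1 = x%:R / Q%:R.
  by rewrite /scaled /= mulrA -natrM -E natrD -mulrBl addrK.
split; first by rewrite ler_pdivrMr // mul1r ler_nat.
by rewrite /scaled /= -mulrDl ltr_pdivlMr // mul1r -natrD ltr_nat.
Qed.

Lemma next_real_scaled Q p : (0 < Q)%N -> in_triangle Q p ->
  next_real (scaled R Q p) = scaled R Q (next_nat Q p).
Proof.
move=> Q0 D; rewrite /next_real index_real_scaled // {2}/scaled /=; congr pair.
rewrite -pmulrn mulrA -natrM -(next_natE D) natrD -mulrBl addrK //.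
Qed.

Lemma L_pair_scaled Q p i : (0 < Q)%N -> in_triangle Q p ->
  L_pair (scaled R Q p) i = scaled R Q (q_pair Q p i).
Proof.
move=> Q0 D; elim: i => //= i IH; rewrite -/(L_pair _ i) IH next_real_scaled //.
exact: q_pair_triangle.
Qed.

Lemma in_region_scaled ks Q p : (0 < Q)%N ->
  in_polygon (region_planes ks) (scaled R Q p) =
  in_triangle Q p && (k_seq (size ks) Q p == ks).
Proof.
move=> Q0; apply/idP/andP.
  move=> /in_region_planes[/farey_triangle_scaled D H]; have {}D := D Q0; split=> //.
  apply/eqP; apply: (@eq_from_nth _ 0%N); rewrite size_mkseq // => i ilt.
  rewrite nth_mkseq //; have := H i ilt; rewrite L_pair_scaled // index_real_scaled //; last exact: q_pair_triangle.
  by move=> [].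
move=> [D /eqP kE]; apply/in_region_planes; split; first exact/farey_triangle_scaled.
move=> i ilt; rewrite L_pair_scaled // index_real_scaled //; last exact: q_pair_triangle.
by rewrite -kE nth_mkseq.
Qed.

End Regions.

(** * Farey sequences *)

Section Farey.
Implicit Types (Q a q b i : nat).

Definition fraction a q : rat := a%:R / q%:R.

Lemma fractionE a q : fraction a q = (a%:Z)%:Q / (q%:Z)%:Q.
Proof. by rewrite /fraction -!pmulrn. Qed.

Lemma numq_fraction a q : (0 < q)%N -> coprime a q -> numq (fraction a q) = a.
Proof. by move=> q0 c; rewrite fractionE coprimeq_num // gtr0_sg ?mul1r // ltz_nat. Qed.

Lemma denq_fraction a q : (0 < q)%N -> coprime a q -> denq (fraction a q) = q.
Proof. by move=> q0 c; rewrite fractionE coprimeq_den //; case: q q0 c. Qed.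

Lemma fraction_inj a q a' q' : (0 < q)%N -> (0 < q')%N -> coprime a q -> coprime a' q' ->
  fraction a q = fraction a' q' -> a = a' /\ q = q'.
Proof.
move=> q0 q0' c c' E; split.
  by have := numq_fraction q0 c; rewrite E numq_fraction // => -[].
by have := denq_fraction q0 c; rewrite E denq_fraction // => -[].
Qed.

Lemma lt_fraction a q a' q' : (0 < q)%N -> (0 < q')%N ->
  (fraction a q < fraction a' q') = (a * q' < a' * q)%N.
Proof.
move=> q0 q0'; rewrite /fraction ltr_pdivrMr ?ltr0n // mulrAC ltr_pdivlMr ?ltr0n //.
by rewrite -!natrM ltr_nat.
Qed.

Definition farey_pairs Q : seq (nat * nat) :=
  [seq (a, q) | q <- iota 1 Q, a <- [seq a <- iota 0 q.+1 | coprime a q]].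

Lemma mem_farey_pairs Q a q : ((a, q) \in farey_pairs Q) =
  [&& (0 < q <= Q)%N, (a <= q)%N & coprime a q].
Proof.
apply/allpairsPdep/idP.
  move=> [q1 [a1 []]]; rewrite mem_filter !mem_iota => h1 /andP[h2 h3] [-> ->].
  by rewrite h2 andbT; lia.
by move=> /and3P[h1 h2 h3]; exists q, a; rewrite mem_filter !mem_iota h3; split=> //; lia.
Qed.

Lemma farey_pairsE Q : perm_eq (farey Q) [seq fraction t.1 t.2 | t <- farey_pairs Q].
Proof. by rewrite /farey perm_sort /farey_pairs map_allpairs. Qed.

Lemma farey_pairs_uniq Q : uniq (farey_pairs Q).
Proof.
apply: allpairs_uniq_dep; first exact: iota_uniq.
  by move=> q _; rewrite filter_uniq // iota_uniq.
by move=> [q a] [q' a'] _ _ /= [-> ->].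
Qed.

Lemma farey_uniq Q : uniq (farey Q).
Proof.
rewrite (perm_uniq (farey_pairsE Q)) map_inj_in_uniq ?farey_pairs_uniq //.
move=> [a q] [a' q']; rewrite !mem_farey_pairs => /and3P[/andP[q0 _] _ c] /and3P[/andP[q0' _] _ c'].
by move=> /(fraction_inj q0 q0' c c')[/= -> ->].
Qed.

Lemma farey_sorted Q : sorted <%R (farey Q).
Proof.
rewrite lt_sorted_uniq_le farey_uniq /farey; apply: sort_sorted; exact: le_total.
Qed.

Lemma mem_fareyP Q x : x \in farey Q ->
  exists a q, [/\ x = fraction a q, (0 < q <= Q)%N, (a <= q)%N & coprime a q].
Proof.
rewrite (perm_mem (farey_pairsE Q)) => /mapP[[a q]]; rewrite mem_farey_pairs.
by move=> /and3P[h1 h2 h3] ->; exists a, q.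
Qed.

Lemma fraction_mem_farey Q a q : (0 < q <= Q)%N -> (a <= q)%N -> coprime a q ->
  fraction a q \in farey Q.
Proof.
move=> h1 h2 h3; rewrite (perm_mem (farey_pairsE Q)); apply/mapP; exists (a, q) => //.
by rewrite mem_farey_pairs h1 h2.
Qed.

Lemma farey_lt_nth Q i j : (i < size (farey Q))%N -> (j < size (farey Q))%N ->
  (nth 0 (farey Q) i < nth 0 (farey Q) j) = (i < j)%N.
Proof. by move=> hi hj; rewrite (lt_sorted_ltn_nth 0 (farey_sorted Q)). Qed.

(* b/s strictly between a/q and a'/q' with a' q - a q' = 1 has
   s = q (a' s - b q') + q' (b q - a s) >= q + q'. *)
Lemma farey_gap a q a' q' b s : (a' * q = a * q' + 1)%N ->
  (a * s < b * q)%N -> (b * q' < a' * s)%N -> (q + q' <= s)%N.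
Proof.
move=> E h1 h2.
have [u Eu] : exists u, (b * q = a * s + 1 + u)%N by exists (b * q - a * s - 1)%N; lia.
have [v Ev] : exists v, (a' * s = b * q' + 1 + v)%N by exists (a' * s - b * q' - 1)%N; lia.
have e1 : (s * (a' * q) = s * (a * q') + s)%N by rewrite E; lia.
have e2 : (q' * (b * q) = q' * (a * s) + q' + q' * u)%N by rewrite Eu; lia.
have e3 : (q * (a' * s) = q * (b * q') + q + q * v)%N by rewrite Ev; lia.
have -> : (s = q + q' + q' * u + q * v)%N by lia.
by lia.
Qed.

(** A Farey fraction strictly between the two would have denominator at least q + q' > Q by
    [farey_gap]. *)
Lemma farey_successor Q i a q a' q' : (i < size (farey Q))%N ->
  nth 0 (farey Q) i = fraction a q -> (0 < q <= Q)%N -> (a < q)%N -> coprime a q ->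
  (0 < q' <= Q)%N -> (Q < q + q')%N -> (a' * q = a * q' + 1)%N ->
  [/\ (i.+1 < size (farey Q))%N, nth 0 (farey Q) i.+1 = fraction a' q',
     (a' <= q')%N & coprime a' q'].
Proof.
move=> isz xi qQ aq c q'Q qq E.
have [q0 q'0] : (0 < q /\ 0 < q')%N by case/andP: qQ; case/andP: q'Q.
have a'q' : (a' <= q')%N by nia.
have c' : coprime a' q'.
  rewrite /coprime -dvdn1 -(dvdn_addr 1 (dvdn_mull a (dvdn_gcdr a' q'))) -E.
  by rewrite dvdn_mulr ?dvdn_gcdl.
have yF : fraction a' q' \in farey Q by exact: fraction_mem_farey.
set j := index (fraction a' q') (farey Q).
have jsz : (j < size (farey Q))%N by rewrite index_mem.
have jE : nth 0 (farey Q) j = fraction a' q' by rewrite nth_index.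
have ij : (i < j)%N.
  by rewrite -(@farey_lt_nth Q) // xi jE lt_fraction // E addn1 ltnS.
have i1sz : (i.+1 < size (farey Q))%N by exact: leq_ltn_trans ij jsz.
have [ij1|ij1] : (j = i.+1 \/ i.+1 < j)%N by lia.
  by split; rewrite -?ij1.
have [b [s [zE /andP[s0 sQ] _ _]]] := mem_fareyP (mem_nth 0 i1sz).
have := farey_lt_nth isz i1sz; rewrite ltnSn xi zE lt_fraction // => h1.
have := farey_lt_nth i1sz jsz; rewrite ij1 jE zE lt_fraction // => h2.
have := farey_gap E h1 h2; lia.
Qed.

Lemma inverse_exists a q : (0 < q)%N -> coprime q a ->
  exists u v, (v * q = a * u + 1)%N.
Proof.
move=> q0 c; case: (egcdnP a q0) => km kn Ek _.
by exists kn, km; rewrite Ek (eqP c) mulnC.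
Qed.

Lemma nth_farey_lt Q i : (i < size (farey Q))%N -> (1 <= Q)%N ->
  (i.+1 < size (farey Q))%N = (nth 0 (farey Q) i < 1).
Proof.
move=> isz Q1; have one : fraction 1 1 \in farey Q by apply: fraction_mem_farey.
have jE : nth 0 (farey Q) (index (fraction 1 1) (farey Q)) = 1 by rewrite nth_index.
have jsz : (index (fraction 1 1) (farey Q) < size (farey Q))%N by rewrite index_mem.
apply/idP/idP => [i1|].
  have := farey_lt_nth isz i1; rewrite ltnSn => /lt_le_trans; apply.
  have [a [q [-> /andP[q0 _] aq _]]] := mem_fareyP (mem_nth 0 i1).
  by rewrite /fraction ler_pdivrMr ?ltr0n // mul1r ler_nat.
by rewrite -jE farey_lt_nth // => /leq_ltn_trans; apply.
Qed.

Lemma farey_neighbours Q i : (1 <= Q)%N -> (i.+1 < size (farey Q))%N ->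
  exists a q a' q', [/\ nth 0 (farey Q) i = fraction a q,
    nth 0 (farey Q) i.+1 = fraction a' q', coprime a q, coprime a' q' &
    [/\ (0 < q <= Q)%N, (0 < q' <= Q)%N, (Q < q + q')%N, (a < q)%N
      & (a' * q = a * q' + 1)%N]].
Proof.
move=> Q1 i1; have isz := ltnW i1.
have [a [q [xE qQ _ c]]] := mem_fareyP (mem_nth 0 isz).
have q0 : (0 < q)%N by case/andP: qQ.
have aq : (a < q)%N.
  by move: i1; rewrite nth_farey_lt // xE /fraction ltr_pdivrMr ?ltr0n // mul1r ltr_nat.
have [u [v uv]] : exists u v, (v * q = a * u + 1)%N.
  by apply: inverse_exists; rewrite // coprime_sym.
have uq := ltn_pmod u q0; have uE := divn_eq u q.
set w := (u %% q)%N in uq uE.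
(* The largest solution up to Q of a q' = -1 modulo q; hence Q - q < q' <= Q, as [farey_successor]
   requires. *)
pose q' := (w + q * ((Q - w) %/ q))%N.
have q'1 : (q' <= Q)%N by have := leq_divM (Q - w) q; rewrite /q'; lia.
have q'2 : (Q < q + q')%N.
  by have := ltn_ceil (Q - w) q0; rewrite /q'; lia.
have q'Q : (0 < q' <= Q)%N by lia.
have : (q %| a * q' + 1)%N.
  have h : (q %| a * w + 1)%N.
    have : (q %| a * u + 1)%N by rewrite -uv dvdn_mull.
    by rewrite uE mulnDr mulnA -addnA dvdn_addr // dvdn_mull.
  by rewrite /q' mulnDr addnAC dvdn_addr // mulnCA dvdn_mulr.
move=> /dvdnP[a' E]; have E' := esym E.
have [_ yE _ c'] := farey_successor isz xE qQ aq c q'Q q'2 E'.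
by exists a, q, a', q'.
Qed.

Lemma farey_denE Q i a q : nth 0 (farey Q) i = fraction a q -> (0 < q)%N -> coprime a q ->
  farey_den Q i = q.
Proof. by move=> E q0 c; rewrite /farey_den E denq_fraction. Qed.

Lemma farey_lattice_point Q i : (1 <= Q)%N -> (i.+1 < size (farey Q))%N ->
  lattice_point Q (farey_den Q i, farey_den Q i.+1).
Proof.
move=> Q1 i1; have [a [q [a' [q' [xE yE c c' [qQ q'Q qq aq E]]]]]] := farey_neighbours Q1 i1.
have [q0 q'0] : (0 < q /\ 0 < q')%N by case/andP: qQ; case/andP: q'Q.
rewrite (farey_denE xE) // (farey_denE yE) // /lattice_point /= qQ q'Q qq /=.
rewrite /coprime -dvdn1 -(dvdn_addr 1 (dvdn_mull a (dvdn_gcdr q q'))) -E.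
by rewrite dvdn_mull ?dvdn_gcdl.
Qed.

(** The two unimodular relations give a' (q'' + q) = q' (a'' + a), so q' divides q'' + q. Both q''
    and the second entry of [next_nat] then lie in one class modulo q' and in the interval from Q -
    q' (excluded) to Q, so they agree. *)
Lemma farey_next_nat Q i : (1 <= Q)%N -> (i.+2 < size (farey Q))%N ->
  next_nat Q (farey_den Q i, farey_den Q i.+1) = (farey_den Q i.+1, farey_den Q i.+2).
Proof.
move=> Q1 i2; have i1 := ltnW i2.
have D : in_triangle Q (farey_den Q i, farey_den Q i.+1).
  by have := farey_lattice_point Q1 i1; rewrite lattice_pointE => /andP[].
have := next_natE D; have := next_nat_triangle D.
have [a [q [a' [q' [xE yE c c' [qQ q'Q qq aq E]]]]]] := farey_neighbours Q1 i1.
have [b' [s' [a'' [q'' [yE' zE e' c'' [s'Q q''Q qq' aq' E']]]]]] := farey_neighbours Q1 i2.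
have [q0 q'0] : (0 < q /\ 0 < q')%N by case/andP: qQ; case/andP: q'Q.
have s'0 : (0 < s')%N by case/andP: s'Q.
have q''0 : (0 < q'')%N by case/andP: q''Q.
have [ba sq] := fraction_inj q'0 s'0 c' e' (etrans (esym yE) yE').
subst b' s'.
rewrite (farey_denE xE) // (farey_denE yE) // (farey_denE zE) //.
rewrite /next_nat /=; set x := (_ - q)%N; set k := index_nat _ _.
move=> /and3P[_ /= /andP[x0 xQ] xq] xE2; congr pair.
have : (q' %| q'' + q)%N.
  rewrite -(Gauss_dvdr _ (m := q') (n := a')); last by rewrite coprime_sym.
  by rewrite (_ : a' * (q'' + q) = q' * (a'' + a))%N ?dvdn_mulr //; lia.
move=> /dvdnP[k' Ek'].
have [kk|kk|kk] := ltngtP k k'; [nia | nia |].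
by subst k'; lia.
Qed.

Lemma farey_q_pair Q i j : (1 <= Q)%N -> (i + j.+1 < size (farey Q))%N ->
  q_pair Q (farey_den Q i, farey_den Q i.+1) j = (farey_den Q (i + j), farey_den Q (i + j).+1).
Proof.
move=> Q1; elim: j => [|j IH] H; first by rewrite addn0.
rewrite /q_pair iterS -/(q_pair _ _ j) IH; last by lia.
by rewrite farey_next_nat // ?addnS //; lia.
Qed.

(** The pair (q, q') recovers the fraction a / q, because a q' = -1 modulo q and a < q; conversely
    this congruence defines a for every coprime pair of the triangle. The last position has no
    successor, hence the predecessor of the size. *)
Lemma count_farey_pairs Q (P : pred (nat * nat)) : (1 <= Q)%N ->
  count (fun i => P (farey_den Q i, farey_den Q i.+1)) (iota 0 (size (farey Q)).-1) =
  count (fun p => coprime p.1 p.2 && P p) (triangle_points Q).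
Proof.
move=> Q1.
have sz i : i \in iota 0 (size (farey Q)).-1 = (i.+1 < size (farey Q))%N.
  by rewrite mem_iota; lia.
apply: (count_bij (f := fun i => (farey_den Q i, farey_den Q i.+1))).
- exact: iota_uniq.
- exact: triangle_points_uniq.
- move=> i j; rewrite !sz => i1 j1 [].
  have [a [q [a' [q' [xE yE c c' [qQ q'Q qq aq E]]]]]] := farey_neighbours Q1 i1.
  have [b [s [b' [s' [zE wE e e' [sQ s'Q ss bs E']]]]]] := farey_neighbours Q1 j1.
  have [q0 q'0] : (0 < q /\ 0 < q')%N by case/andP: qQ; case/andP: q'Q.
  have [s0 s'0] : (0 < s /\ 0 < s')%N by case/andP: sQ; case/andP: s'Q.
  rewrite (farey_denE xE) // (farey_denE yE) // (farey_denE zE) // (farey_denE wE) //.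
  move=> ? ?; subst s s'.
  have ab : a = b.
    have cq : coprime q q'.
      rewrite /coprime -dvdn1 -(dvdn_addr 1 (dvdn_mull a (dvdn_gcdr q q'))) -E.
      by rewrite dvdn_mull ?dvdn_gcdl.
    have : (a * q' + 1 == b * q' + 1 %[mod q])%N by rewrite -E -E' !modnMl.
    rewrite eqn_modDr; have [le|/ltnW le] := leqP b a.
      rewrite eqn_mod_dvd ?leq_mul2r ?le ?orbT // -mulnBl Gauss_dvdl //.
      by move=> /dvdnP[[|k] Hk]; nia.
    rewrite eq_sym eqn_mod_dvd ?leq_mul2r ?le ?orbT // -mulnBl Gauss_dvdl //.
    by move=> /dvdnP[[|k] Hk]; nia.
  apply/eqP; rewrite -(nth_uniq 0 (ltnW i1) (ltnW j1) (farey_uniq Q)).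
  by rewrite xE zE ab.
- move=> i; rewrite sz => i1 Pi; rewrite mem_triangle_points Pi andbT.
  by have := farey_lattice_point Q1 i1; rewrite lattice_pointE.
move=> [q q']; rewrite mem_triangle_points => D /andP[/= c Pq].
have /and3P[/= qQ q'Q qq] := D; have q0 : (0 < q)%N by case/andP: qQ.
have [u [v uv]] := inverse_exists q0 c.
pose a := (u %% q)%N; have aq : (a < q)%N by exact: ltn_pmod.
have : (q %| a * q' + 1)%N.
  have : (q %| q' * u + 1)%N by rewrite -uv dvdn_mull.
  by rewrite {1}(divn_eq u q) mulnDr mulnA -addnA dvdn_addr ?dvdn_mull // mulnC.
move=> /dvdnP[a' /esym E].
have ca : coprime a q.
  rewrite /coprime -dvdn1 -(dvdn_addr 1 (dvdn_mulr q' (dvdn_gcdl a q))) -E.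
  by rewrite dvdn_mull ?dvdn_gcdr.
have xF : fraction a q \in farey Q by apply: fraction_mem_farey => //; exact: ltnW.
pose i := index (fraction a q) (farey Q).
have isz : (i < size (farey Q))%N by rewrite index_mem.
have xE : nth 0 (farey Q) i = fraction a q by rewrite nth_index.
have [i1 yE a'q' c'] := farey_successor isz xE qQ aq ca q'Q qq E.
have q'0 : (0 < q')%N by case/andP: q'Q.
have e1 := farey_denE xE q0 ca; have e2 := farey_denE yE q'0 c'.
by exists i; rewrite sz e1 e2.
Qed.

Lemma size_farey_gt0 Q : (1 <= Q)%N -> (0 < size (farey Q))%N.
Proof.
move=> Q1; have : fraction 1 1 \in farey Q by apply: fraction_mem_farey.
by case: (farey Q).
Qed.

Lemma size_farey Q : (1 <= Q)%N ->
  size (farey Q) = (count (fun p => coprime p.1 p.2) (triangle_points Q)).+1.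
Proof.
move=> Q1; have := @count_farey_pairs Q xpredT Q1.
rewrite count_predT size_iota (eq_count (a2 := fun p => coprime p.1 p.2)); last first.
  by move=> p; rewrite /= andbT.
by move=> <-; rewrite prednK ?size_farey_gt0.
Qed.

Definition residue_tuple r (c : r.-tuple nat) d Q (p : nat * nat) : bool :=
  [forall j : 'I_r, (q_pair Q p j).1 == tnth c j %[mod d]]%N.

(** The orbit of a lattice point continues past the end of the Farey sequence, whereas a tuple must
    fit inside it; at most r starting positions are affected. *)
Lemma num_tuples_count r (c : r.-tuple nat) d Q : (1 < r)%N -> (1 <= Q)%N ->
  (num_tuples Q c d
     <= count (fun p => coprime p.1 p.2 && residue_tuple c d Q p) (triangle_points Q)
     <= num_tuples Q c d + r)%N.
Proof.
move=> r1 Q1; rewrite -(count_farey_pairs (residue_tuple c d Q)) //.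
set n := size (farey Q); have n0 : (0 < n)%N := size_farey_gt0 Q1.
pose P i := residue_tuple c d Q (farey_den Q i, farey_den Q i.+1).
have -> : num_tuples Q c d = count (fun i => (i + r <= n)%N && P i) (iota 0 n.-1).
  rewrite /num_tuples -/n (_ : iota 0 n = iota 0 n.-1 ++ [:: n.-1]); last first.
    by rewrite -{1}(prednK n0) -[n.-1.+1]addn1 iotaD.
  rewrite count_cat /= addn0.
  rewrite (_ : (n.-1 + r <= n)%N = false) /=; last by lia.
  rewrite addn0; apply: eq_in_count => i _; case: leqP => //= ir.
  apply: eq_forallb => j; congr (_ == _ %[mod d])%N.
  case: j => -[|j] /= jr; first by rewrite addn0.
  by rewrite -/(q_pair _ _ j) farey_q_pair ?addnS //=; lia.
apply/andP; split; first by apply: sub_count => i /andP[].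
pose A i := (i + r <= n)%N && P i; pose B i := (n < i + r)%N.
have cB : (count B (iota 0 n.-1) <= r)%N.
  rewrite -size_filter -[X in (_ <= X)%N](size_iota (n.+1 - r)).
  apply: uniq_leq_size; first by rewrite filter_uniq ?iota_uniq.
  by move=> i; rewrite mem_filter /B !mem_iota; lia.
apply: leq_trans (leq_add (leqnn _) cB); rewrite -count_predUI.
apply: leq_trans (leq_addr _ _); apply: sub_count => i Pi.
by rewrite /= /A /B /P Pi; case: leqP.
Qed.
End Farey.

(** * Coprime points in a region *)

Section RegionCounts.
Variable R : realType.
Implicit Types (ks : seq nat) (Q d u v K : nat).

Definition region_count ks d u v Q : nat :=
  count (fun p => [&& coprime p.1 p.2, k_seq (size ks) Q p == ks,
    p.1 == u %[mod d] & p.2 == v %[mod d]]) (triangle_points Q).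

Definition region_area ks : R := polygon_area (region_planes R ks).

(** Expected number, per unit of area, of coprime points in a class (u, v) modulo d with gcd(u, v,
    d) = 1. *)
Definition density d Q : R := Q%:R ^+ 2 / d%:R ^+ 2 * mobius_sum R d Q.

Lemma region_countE ks d u v Q : (0 < Q)%N ->
  region_count ks d u v Q =
  count (fun t => (in_polygon (region_planes R ks) (scaled R Q t) &&
      ((t.1 == u %[mod d]) && (t.2 == v %[mod d]))) && coprime t.1 t.2) (points Q).
Proof.
move=> Q0; rewrite /region_count -count_triangle; apply: eq_count => p; cbv beta.
rewrite in_region_scaled //; case: in_triangle => //=.
by case: coprime; rewrite /= ?andbT ?andbF.
Qed.

Lemma region_count_approx ks d u v Q : (0 < Q)%N -> (0 < d)%N -> coprime (gcdn u v) d ->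
  `|(region_count ks d u v Q)%:R - region_area ks * density d Q|
    <= (15 * (5 + 2 * size ks))%:R * (Q%:R * (1 + ln Q%:R)).
Proof.
move=> Q0 d0 c; rewrite region_countE // /density [_ * (Q%:R * _)]mulrA [region_area _ * _]mulrA
  [region_area _ * (_ / _)]mulrA.
apply: coprime_residue_count => // m /andP[m0 mQ] cmd.
apply: le_trans (residue_count_coprime u v Q0 d0 m0 cmd (lexx 0) (lexx 0) ler01 _) _.
  exact: region_box.
have mR : 0 < m%:R :> R by rewrite ltr0n.
(* As m <= Q, the boundary term is absorbed by Q/m + 2 <= 3 Q/m, which explains 15 = 5 * 3. *)
have h : 1 <= Q%:R / m%:R :> R by rewrite ler_pdivlMr // mul1r ler_nat.
rewrite size_region_planes mul1r natrM -[X in _ <= X]mulrA.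
move: (Q%:R / m%:R) h => x h; have : 0 <= (5 + 2 * size ks)%:R :> R by [].
move: (5 + 2 * size ks)%:R => n n0; nra.
Qed.

Lemma region_area_ge0 ks : 0 <= region_area ks.
Proof. by apply: fine_ge0; exact: measure_ge0. Qed.

Lemma area_region ks : area [set z | in_polygon (region_planes R ks) z] = (region_area ks)%:E.
Proof.
by have [] := @count_residue R (region_planes R ks) 1 1 0 0 0 0 1 isT isT isT
  (lexx 0) (lexx 0) ler01 (@region_box R ks).
Qed.

Lemma area_T_region s (k : s.-tuple nat) : area (@T_region R s k) = (region_area k)%:E.
Proof. by rewrite T_regionE area_region. Qed.

Lemma region_area1_le K : (2 <= K)%N -> region_area [:: K] <= 4 / K%:R ^+ 2.
Proof.
move=> K2; have KR : 0 < K%:R :> R by rewrite ltr0n; lia.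
have q0 : 0 < 2 / K%:R :> R by rewrite divr_gt0.
rewrite -lee_fin -area_region.
apply: (@le_trans _ _ (area (`]1 - 2 / K%:R, 1] `*` `]0, 2 / K%:R]))); last first.
  rewrite area_rectangle ?lee_fin; [|lra|exact: ltW].
  by rewrite le_eqVlt; apply/orP; left; apply/eqP; field; rewrite gt_eqF.
apply: le_measure; rewrite ?inE; [exact: measurable_polygon|exact: measurable_rectangle|].
move=> z Pz; have [_ /andP[_ y2] /andP[x1 x2] /andP[y1 _]] := region_box1 (ltnW K2) Pz.
move: Pz => /in_region_planes[[_ _ xy] _]; rewrite add0r in y2.
by split; rewrite /= in_itv /=; apply/andP; split; lra.
Qed.

(** Put x = Q / (K m). While m K <= 2 Q, one has 2 <= 4 x, and the box of side 2 / K with 7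
    half-planes gives the error 35 (2 x + 2) <= 210 x. This gain of 1 / K is what makes the sum over
    K converge to a logarithm. *)
Lemma region_count1_approx K d u v Q :
  (2 <= K)%N -> (0 < Q)%N -> (0 < d)%N -> coprime (gcdn u v) d ->
  `|(region_count [:: K] d u v Q)%:R - region_area [:: K] * density d Q|
    <= 210 / K%:R * (Q%:R * (1 + ln Q%:R)).
Proof.
move=> K2 Q0 d0 c; have K0 : (0 < K)%N by lia.
have KR : 0 < K%:R :> R by rewrite ltr0n.
have QR : 0 < Q%:R :> R by rewrite ltr0n.
rewrite region_countE // /density [_ * (Q%:R * _)]mulrA [region_area _ * _]mulrA
  [region_area _ * (_ / _)]mulrA.
apply: coprime_residue_count => // m /andP[m0 mQ] cmd.
have mR : 0 < m%:R :> R by rewrite ltr0n.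
have [le|lt] := leqP (m * K) (2 * Q).
  have x0 : 0 <= 1 - 2 / K%:R :> R.
    by rewrite subr_ge0 ler_pdivrMr // mul1r ler_nat.
  have s0 : 0 <= 2 / K%:R :> R by rewrite divr_ge0.
  apply: le_trans (residue_count_coprime u v Q0 d0 m0 cmd x0 (lexx 0) s0 _) _.
    by move=> z; exact: region_box1.
  rewrite size_region_planes /=.
  have h : 2 <= 4 * (Q%:R / (K%:R * m%:R)) :> R.
    rewrite mulrA ler_pdivlMr ?mulr_gt0 //.
    by move: le; rewrite -(ler_nat R) !natrM; lra.
  rewrite (_ : 2 / K%:R * Q%:R / m%:R = 2 * (Q%:R / (K%:R * m%:R)));
    last by field; rewrite !gt_eqF.
  rewrite (_ : 210 / K%:R * Q%:R / m%:R = 210 * (Q%:R / (K%:R * m%:R)));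
    last by field; rewrite !gt_eqF.
  rewrite (_ : (5 + 2 * 1)%N = 7%N) //.
  by move: (Q%:R / _) h => x h; lra.
(* When m K > 2 Q, a point with m | t.2 would have K t.2 > 2 Q >= Q + t.1, impossible for index K.
   Only the main term remains, at most 4 x^2 with 2 x <= 1. *)
rewrite /residue_count (eq_in_count (a2 := pred0)) ?count_pred0; last first.
  move=> t /[!mem_points] tQ; apply/negbTE/negP; rewrite in_region_scaled //.
  move=> /andP[/andP[/andP[D /eqP[kE]] _] /andP[_ m2]].
  have t2 : (0 < t.2)%N by case/andP: tQ => _ /andP[].
  have mt2 := dvdn_leq t2 m2; have [_] := index_natP D.
  have : (m * K <= K * t.2)%N by rewrite mulnC leq_mul2l mt2 orbT.
  rewrite kE; case/andP: tQ => /andP[_ t1Q] _ h1 h2.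
  have := leq_trans lt (leq_trans h1 h2).
  by rewrite mul2n -addnn ltn_add2l ltnNge t1Q.
rewrite sub0r normrN ger0_norm; last first.
  by rewrite divr_ge0 ?mulr_ge0 ?exprn_ge0 // region_area_ge0.
apply: (@le_trans _ _ (4 / K%:R ^+ 2 * Q%:R ^+ 2 / m%:R ^+ 2)).
  apply: ler_pM; rewrite ?invr_ge0 ?mulr_ge0 ?exprn_ge0 ?region_area_ge0 //.
    by rewrite ler_wpM2r ?exprn_ge0 // region_area1_le.
  rewrite lef_pV2 ?posrE ?exprn_gt0 ?ltr0n ?muln_gt0 ?m0 ?d0 //.
  by rewrite -!natrX ler_nat leq_exp2r // leq_pmulr.
have h : 2 * (Q%:R / (K%:R * m%:R)) <= 1 :> R.
  rewrite mulrA ler_pdivrMr ?mulr_gt0 // mul1r.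
  by move: lt; rewrite -(ltr_nat R) !natrM; lra.
rewrite (_ : 4 / K%:R ^+ 2 * Q%:R ^+ 2 / m%:R ^+ 2 = 4 * (Q%:R / (K%:R * m%:R)) ^+ 2);
  last by field; rewrite !gt_eqF.
rewrite (_ : 210 / K%:R * Q%:R / m%:R = 210 * (Q%:R / (K%:R * m%:R)));
  last by field; rewrite !gt_eqF.
have : 0 <= Q%:R / (K%:R * m%:R) :> R by rewrite divr_ge0 ?mulr_ge0.
by move: (Q%:R / _) h => x h x0; nra.
Qed.

(** All lattice points, modulus 1: the error is O(Q), so these counts determine the area in the
    limit. *)
Lemma full_count_approx ks Q : (0 < Q)%N ->
  `|(count (fun p => k_seq (size ks) Q p == ks) (triangle_points Q))%:R
     - region_area ks * Q%:R ^+ 2|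
   <= (5 * (5 + 2 * size ks))%:R * (Q%:R + 2).
Proof.
move=> Q0; have := count_residue Q0 (isT : (0 < 1)%N) (isT : (0 < 1)%N)
  (lexx 0) (lexx 0) ler01 (@region_box R ks).
rewrite (eq_count (a2 := fun p => in_triangle Q p && (k_seq (size ks) Q p == ks))); last first.
  by move=> p; cbv beta; rewrite in_region_scaled // !modn1 eqxx !andbT.
by rewrite count_triangle size_region_planes mul1r expr1n !divr1 natrM => -[].
Qed.

Lemma eq0_of_sub_quadratic (x C : R) :
  (forall Q, (0 < Q)%N -> `|x| * Q%:R ^+ 2 <= C * (Q%:R + 2)) -> x = 0.
Proof.
move=> H; apply/eqP; rewrite -normr_le0 leNgt; apply/negP => x0.
have C0 : 0 <= C.
  have := H 1%N isT; rewrite expr1n mulr1 => h.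
  by rewrite -(pmulr_lge0 _ (_ : 0 < 1 + 2)) //; apply: le_trans h.
pose Q := (Num.truncn (3 * C / `|x|)).+1.
have Q1 : 1 <= Q%:R :> R by rewrite ler1n.
have : 3 * C / `|x| < Q%:R by exact: truncnS_gt.
rewrite ltr_pdivrMr //; have := H Q isT.
by move: (Q%:R) (`|x|) Q1 x0 => q y q1 y0 h1 h2; nra.
Qed.

Lemma sum_iota1 n : (2 * \sum_(x <- iota 1 n) x = n * n.+1)%N.
Proof.
elim: n => [|n IH]; first by rewrite big_nil.
rewrite (_ : iota 1 n.+1 = iota 1 n ++ [:: n.+1]); last by have := iotaD 1 n 1; rewrite addn1.
by rewrite big_cat big_seq1 /= mulnDr IH; lia.
Qed.

Lemma size_triangle_points Q : (2 * size (triangle_points Q) = Q * Q.+1)%N.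
Proof.
rewrite size_filter /points count_allpairs -sum_iota1 !big_seq; congr (2 * _)%N.
apply: eq_bigr => x; rewrite mem_iota => xQ.
rewrite (_ : iota 1 Q = iota 1 (Q - x) ++ iota (1 + (Q - x)) x); last by rewrite -iotaD subnK //; lia.
rewrite count_cat (eq_in_count (a2 := pred0)); last first.
  by move=> y; rewrite mem_iota /in_triangle /=; lia.
rewrite count_pred0 (eq_in_count (a2 := predT)) ?count_predT ?size_iota //.
by move=> y; rewrite mem_iota /in_triangle /=; lia.
Qed.

(** Read off from the exact count Q (Q + 1) / 2 by letting Q grow. *)
Lemma region_area_nil : region_area [::] = 1 / 2.
Proof.
apply/eqP; rewrite -subr_eq0; apply/eqP; apply: (@eq0_of_sub_quadratic _ 26) => Q Q0.
have := full_count_approx [::] Q0.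
rewrite (eq_count (a2 := predT)) ?count_predT; last by move=> p; rewrite /= /k_seq /mkseq.
have := size_triangle_points Q; move=> /(congr1 (fun n => n%:R : R)).
rewrite (_ : (5 * (5 + 2 * size [::]))%N = 25%N) // !natrM -[Q.+1%:R]natr1 => nq h.
move: nq h.
have Q1 : 1 <= Q%:R :> R by rewrite ler1n.
rewrite -[X in `|_| * X](ger0_norm (sqr_ge0 Q%:R)) -normrM.
move: (region_area _) (size _)%:R Q%:R Q1 => a n q q1 nq.
rewrite !ler_norml expr2 => /andP[h1 h2]; rewrite mulrBl.
by apply/andP; split; lra.
Qed.

(** At every scale Q' the two regions contain equally many lattice points: moving j steps permutes
    the points of the triangle, and a large index at position j already determines the whole vector.
    The areas therefore differ by O(1/Q') for all Q'. *)
Lemma region_area_large Q p s j : in_triangle Q p -> (j < s)%N ->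
  (10 * s + 10 < nth 0 (k_seq s Q p) j)%N ->
  region_area (k_seq s Q p) = region_area [:: nth 0%N (k_seq s Q p) j].
Proof.
move=> D js large; set ks := k_seq s Q p; set K := nth 0%N ks j.
have sz : size ks = s by rewrite size_mkseq.
apply/eqP; rewrite -subr_eq0; apply/eqP.
apply: (@eq0_of_sub_quadratic _ ((5 * (5 + 2 * s))%:R + 35)) => Q' Q'0.
have := full_count_approx ks Q'0; have := full_count_approx [:: K] Q'0.
rewrite sz (_ : count (fun q => k_seq s Q' q == ks) _ =
   count (fun q => k_seq (size [:: K]) Q' q == [:: K]) (triangle_points Q')); last first.
  rewrite -[RHS](count_q_pair _ _ j); apply: eq_in_count => q.
  rewrite mem_triangle_points => D'; cbv beta.
  rewrite [k_seq (size [:: K]) _ _]/k_seq /mkseq [map _ _]/= eqseq_cons andbT.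
  apply/eqP/eqP => [E|E]; first by rewrite /K -E nth_mkseq.
  apply/esym; apply: (k_large_unique D D' js large).
  by rewrite [RHS]nth_mkseq // E.
rewrite -[X in _ -> _ -> `|_| * X <= _](ger0_norm (sqr_ge0 Q'%:R)) -normrM mulrBl.
rewrite (_ : (5 * (5 + 2 * size [:: K]))%N = 35%N) //.
move: (count _ _)%:R (region_area ks * _) (region_area _ * _) => n a b.
have : 0 <= Q'%:R + 2 :> R by rewrite addr_ge0.
move: (Q'%:R + 2) (5 * _)%:R => q m q0.
rewrite !ler_norml mulrDl => /andP[h1 h2] /andP[h3 h4].
by apply/andP; split; lra.
Qed.

End RegionCounts.

(** * Summation over the admissible vectors *)

Section BoundedTuples.
Local Open Scope nat_scope.

Definition bounded_tuples s M : seq (s.-tuple nat) :=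
  [seq map_tuple (@nat_of_ord M.+1) t | t <- enum {: s.-tuple 'I_M.+1}].

Lemma bounded_tuples_uniq s M : uniq (bounded_tuples s M).
Proof.
rewrite map_inj_uniq ?enum_uniq // => t t' /(congr1 val) /= /inj_map E.
by apply: val_inj; apply: E; exact: ord_inj.
Qed.

Lemma mem_bounded_tuples s M k : (k \in bounded_tuples s M) = all (leq^~ M) k.
Proof.
apply/mapP/allP => [[t _ ->] x /mapP[y _ ->]|H]; first by rewrite -ltnS.
exists (map_tuple inord k); first by rewrite mem_enum.
apply: val_inj; rewrite /= -map_comp map_id_in // => x xk /=.
by rewrite inordK // ltnS; exact: H.
Qed.

End BoundedTuples.

Section Sums.
Variable R : realType.

Lemma ler_sum_inj (T U : eqType) (l : seq T) (l' : seq U) (g : T -> U) (f : U -> R) :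
  uniq l -> uniq l' -> {in l &, injective g} -> {subset map g l <= l'} ->
  (forall x, x \in l' -> 0 <= f x) ->
  \sum_(k <- l) f (g k) <= \sum_(x <- l') f x.
Proof.
move=> ul ul' gi sub f0.
rewrite -(big_map g xpredT f) (_ : \sum_(x <- map g l) f x = \sum_(x <- l' | x \in map g l) f x).
  rewrite big_mkcond big_seq [X in _ <= X]big_seq; apply: ler_sum => x xl.
  by case: ifP => // _; exact: f0.
rewrite -[RHS]big_filter; apply: perm_big; apply: uniq_perm.
- by rewrite map_inj_in_uniq.
- exact: filter_uniq.
by move=> x; rewrite mem_filter; apply/idP/andP => [xg|[]//]; split=> //; exact: sub.
Qed.

End Sums.

(** * Vectors of [K_set] with large entries, and the total area *)

Section Admissible.
Variable R : realType.
Variables (r d : nat) (c : r.-tuple nat).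
Hypothesis r3 : (3 <= r)%N.
Let s := (r - 2)%N.
Let B := (10 * s + 10)%N.
Let cn i := nth 0%N c i.
Let inK (k : s.-tuple nat) : bool := `[< K_set c d k >].
Local Notation area_of := (@region_area R).

Lemma K_setP k : inK k -> exists Q p,
  [/\ in_triangle Q p, coprime p.1 p.2, k_seq s Q p = k &
      forall i, (i < r)%N -> (q_pair Q p i).1 = cn i %[mod d]].
Proof.
move=> /asboolP[_ [Q [p [Q1 Lp kE H]]]]; exists Q, p.
move: Lp; rewrite lattice_pointE => /andP[D cp]; split=> //.
  by rewrite -val_k_vec; congr val.
by move=> i ir; have := H (Ordinal ir); rewrite tnth_mktuple (tnth_nth 0%N).
Qed.

Lemma K_set_k_vec Q p : in_triangle Q p -> coprime p.1 p.2 -> residue_tuple c d Q p ->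
  inK (k_vec s Q p).
Proof.
move=> D cp /forallP H; apply/asboolP.
have Q1 : (1 <= Q)%N by move/and3P: D => [/andP[? ?] _ _]; lia.
have Lp : lattice_point Q p by rewrite lattice_pointE D.
split; last first.
  exists Q, p; split=> // j; rewrite tnth_mktuple; exact/eqP.
split; last by exists Q, p.
move=> i; rewrite tnth_mktuple; apply: index_nat_gt0; exact: q_pair_triangle.
Qed.

(** The residues come from two neighbouring denominators, which are coprime; a common factor of the
    residues and d would divide both. This supplies the hypothesis of the Moebius inversion. *)
Lemma K_set_coprime k j : inK k -> (j <= s)%N -> coprime (gcdn (cn j) (cn j.+1)) d.
Proof.
move=> /K_setP[Q [p [D cp kE H]]] js.
rewrite -(coprime_q_pair j D) q_pair2 in cp.
have [rj rj1] : (j < r)%N /\ (j.+1 < r)%N by move: js r3; rewrite /s; clear; split; lia.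
have e1 := H j rj; have e2 := H j.+1 rj1.
move: cp e1 e2; move: (q_pair Q p j).1 (q_pair Q p j.+1).1 => x y cp e1 e2.
rewrite /coprime -dvdn1 -(eqP cp).
set g := gcdn _ d; have gd : (g %| d)%N := dvdn_gcdr _ _.
have go w z : z = w %[mod d] -> (g %| w)%N -> (g %| z)%N.
  move=> zw gw; rewrite (divn_eq z d) dvdn_addr ?dvdn_mull // zw.
  by move: gw; rewrite {1}(divn_eq w d) dvdn_addr ?dvdn_mull.
have gu : (g %| gcdn (cn j) (cn j.+1))%N := dvdn_gcdl _ _.
rewrite dvdn_gcd (go _ _ e1) ?(go _ _ e2) //; first exact: dvdn_trans gu (dvdn_gcdr _ _).
exact: dvdn_trans gu (dvdn_gcdl _ _).
Qed.

Lemma K_set_large_inj j k k' : inK k -> inK k' -> (j < s)%N -> (B < nth 0 k j)%N ->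
  nth 0%N k j = nth 0%N k' j -> k = k'.
Proof.
move=> /K_setP[Q [p [D _ kE _]]] /K_setP[Q' [p' [D' _ kE' _]]] js; rewrite -kE -kE' => large E.
by apply: val_inj; rewrite /= -kE -kE'; exact: k_large_unique D D' js large E.
Qed.

Lemma region_area_K_set j k : inK k -> (j < s)%N -> (B < nth 0 k j)%N ->
  area_of k = area_of [:: nth 0%N k j].
Proof.
by move=> /K_setP[Q [p [D _ kE _]]] js; rewrite -kE => large; exact: region_area_large.
Qed.

(** Moving j steps permutes the triangle and preserves coprimality; the large index recovers k. The
    residue conditions at positions 0, 1 and at j, j+1 are equivalent by comparison with the orbit
    that witnesses membership of k in [K_set]. *)
Lemma region_count_K_set j k Q : inK k -> (j < s)%N -> (B < nth 0 k j)%N ->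
  region_count k d (cn 0) (cn 1) Q =
  region_count [:: nth 0%N k j] d (cn j) (cn j.+1) Q.
Proof.
move=> /K_setP[Q0 [p0 [D0 c0 kE H0]]] js large; rewrite /region_count -[RHS](count_q_pair _ _ j).
have sr : s.+2 = r by rewrite /s; lia.
apply: eq_in_count => p; rewrite mem_triangle_points => D; cbv beta.
rewrite coprime_q_pair // size_tuple -/s.
rewrite [k_seq (size [:: _]) _ _]/k_seq /mkseq [map _ _]/= eqseq_cons andbT.
have -> : (index_nat Q (q_pair Q p j) == nth 0%N k j) = (k_seq s Q p == k).
  apply/eqP/eqP => [E|<-]; last by rewrite nth_mkseq.
  apply/esym; rewrite -kE; apply: (k_large_unique D0 D js); rewrite kE //.
  by rewrite nth_mkseq // E.
case: (coprime _ _) => //=; case: eqP => //= Ek.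
have Ek' : k_seq s Q p = k_seq s Q0 p0 by rewrite kE.
have js' : (j <= s)%N := ltnW js.
have hj i : (i < r)%N -> ((q_pair Q p i).1 == cn i %[mod d])%N =
    ((q_pair Q p i).1 == (q_pair Q0 p0 i).1 %[mod d])%N by move=> ir; rewrite H0.
have [r0 r1 rj rj1] : [/\ (0 < r)%N, (1 < r)%N, (j < r)%N & (j.+1 < r)%N].
  by move: js sr; clear; split; lia.
rewrite -[p.1]/(q_pair Q p 0).1 -[p.2]/(q_pair Q p 1).1 q_pair2 !hj //.
apply/andP/andP => -[/eqP e1 /eqP e2].
  have h := q_pair_congr D D0 Ek' (leq0n s) e1 e2.
  by split; apply/eqP; apply: h; rewrite sr.
have h := q_pair_congr D D0 Ek' js' e1 e2.
by split; apply/eqP; apply: h; rewrite sr.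
Qed.

(** Charging every entry above T, instead of one chosen entry, allows the sum over vectors to be
    exchanged with the sum over positions. *)
Definition tail_weight (T : nat) (f : nat -> R) (k : seq nat) : R :=
  \sum_(j <- iota 0 s) if (T < nth 0%N k j)%N then f (nth 0%N k j) else 0.

Lemma tail_weight_ge T f k j : (forall n, 0 <= f n) -> (j < s)%N -> (T < nth 0 k j)%N ->
  f (nth 0%N k j) <= tail_weight T f k.
Proof.
move=> f0 js large; rewrite /tail_weight (bigD1_seq j) ?iota_uniq ?mem_iota //= large.
by rewrite lerDl sumr_ge0 // => i _; case: ifP.
Qed.

Lemma tail_weight_ge0 T f k : (forall n, 0 <= f n) -> 0 <= tail_weight T f k.
Proof. by move=> f0; apply: sumr_ge0 => i _; case: ifP. Qed.

(** At a fixed position j a vector of [K_set] is determined by its entry there once that entry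
    exceeds B. The s positions produce the factor r of the final error. *)
Lemma sum_tail_weight T M (f : nat -> R) : (B <= T)%N -> (forall n, 0 <= f n) ->
  \sum_(k <- bounded_tuples s M | inK k) tail_weight T f k
    <= s%:R * \sum_(K <- iota T.+1 (M - T)) f K.
Proof.
move=> BT f0; rewrite exchange_big /=.
apply: (@le_trans _ _ (\sum_(j <- iota 0 s) \sum_(K <- iota T.+1 (M - T)) f K)); last first.
  by rewrite big_const_seq count_predT size_iota iter_addr_0 mulr_natl.
rewrite big_seq [X in _ <= X]big_seq; apply: ler_sum => j; rewrite mem_iota add0n => /andP[_ js].
rewrite -big_mkcondr /= -big_filter.
apply: (@ler_sum_inj _ _ _ _ _ (fun k : s.-tuple nat => nth 0%N k j) f).
- by rewrite filter_uniq ?bounded_tuples_uniq.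
- exact: iota_uniq.
- move=> k k'; rewrite !mem_filter => /andP[/andP[Kk Tk] _] /andP[/andP[Kk' Tk'] _] E.
  by apply: K_set_large_inj js _ E => //; exact: leq_ltn_trans BT Tk.
- move=> x /mapP[k]; rewrite mem_filter mem_bounded_tuples => /andP[/andP[_ Tk] /allP kM] ->.
  have := kM (nth 0%N k j) (mem_nth _ _); rewrite size_tuple => /(_ js) /=.
  by rewrite mem_iota; lia.
- by [].
Qed.

Lemma tail_index T (k : s.-tuple nat) : ~~ all (leq^~ T) k ->
  exists2 j, (j < s)%N & (T < nth 0 k j)%N.
Proof.
rewrite -has_predC => /(has_nthP 0%N)[j]; rewrite size_tuple => js /=.
by rewrite -ltnNge => H; exists j.
Qed.

Definition partial_area M : R := \sum_(k <- bounded_tuples s M | inK k) area_of k.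

Lemma partial_area_tail M M' : (B <= M)%N ->
  partial_area M' <= partial_area M + 4 * s%:R / M%:R.
Proof.
move=> BM; rewrite /partial_area (bigID (fun k : s.-tuple nat => all (leq^~ M) k)) /=.
apply: lerD.
  rewrite -big_filter -[X in _ <= X]big_filter.
  apply: (@ler_sum_inj R _ _ _ _ id) => //; rewrite ?filter_uniq ?bounded_tuples_uniq //.
    move=> k; rewrite map_id !mem_filter !mem_bounded_tuples => /andP[/andP[-> ->]] //.
  by move=> k _; exact: region_area_ge0.
pose f (n : nat) : R := 4 * (n%:R ^+ 2)^-1.
have f0 n : 0 <= f n by rewrite mulr_ge0 ?invr_ge0 ?exprn_ge0.
apply: (@le_trans _ _ (\sum_(k <- bounded_tuples s M' | inK k) tail_weight M f k)).
  rewrite big_mkcondr; apply: ler_sum => k Kk; case: ifP => [h|_]; last exact: tail_weight_ge0.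
  have [j js Mj] := tail_index h.
  apply: le_trans (tail_weight_ge f0 js Mj).
  rewrite (region_area_K_set Kk js (leq_ltn_trans BM Mj)).
  by apply: region_area1_le; rewrite /B in BM; lia.
apply: (le_trans (sum_tail_weight _ BM f0)).
have M0 : (0 < M)%N by rewrite /B in BM; lia.
rewrite -mulr_sumr mulrCA mulrA ler_wpM2l ?mulr_ge0 //.
by apply: (le_trans (sum_inv_sqr_le _ _ M0)); rewrite gerBl invr_ge0.
Qed.

(** Every finite set of vectors is bounded by some M', and [partial_area_tail] is uniform in M'. In
    particular the sum is finite, so [fine] returns its value and not the default 0. *)
Lemma total_area_bounds M : (B <= M)%N ->
  partial_area M <= total_area R c d <= partial_area M + 4 * s%:R / M%:R.
Proof.
move=> BM.
have lower : ((partial_area M)%:E <= \esum_(k in K_set c d) area (@T_region R s k))%E.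
  apply: esum_ge; exists [set` [seq k <- bounded_tuples s M | inK k]].
    split; first exact: finite_seq.
    by move=> k /=; rewrite mem_filter => /andP[/asboolP].
  rewrite -fsbig_seq ?filter_uniq ?bounded_tuples_uniq //.
  under eq_bigr do rewrite area_T_region.
  by rewrite sumEFin big_filter.
have upper : (\esum_(k in K_set c d) area (@T_region R s k)
    <= (partial_area M + 4 * s%:R / M%:R)%:E)%E.
  apply: ge_ereal_sup => _ [X [finX XK] <-].
  have /finite_seqP[l Xl] := finX.
  pose l' := undup l; have XE : X = [set` l'].
    by rewrite Xl; apply/seteqP; split => k /=; rewrite mem_undup.
  rewrite XE -fsbig_seq ?undup_uniq //.
  under eq_bigr do rewrite area_T_region.
  rewrite sumEFin lee_fin.
  have [M' HM'] : exists M', forall k, k \in l' -> all (leq^~ M') (val k).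
    elim: (l') => [|k t [M1 IH]]; first by exists 0%N.
    exists (maxn M1 (\max_(x <- val k) x)) => k'; rewrite inE => /orP[/eqP->|/IH /allP h].
      apply/allP => x xk; rewrite /= leq_max; apply/orP; right.
      by rewrite -[x]/(id x); apply: leq_bigmax_seq.
    by apply/allP => x /h /= xM; rewrite leq_max xM.
  apply: le_trans (partial_area_tail M' BM); rewrite /partial_area -[X in _ <= X]big_filter.
  apply: (@ler_sum_inj R _ _ _ _ id) => //; rewrite ?undup_uniq ?filter_uniq ?bounded_tuples_uniq //.
    move=> k; rewrite map_id mem_filter mem_bounded_tuples => kl; rewrite HM' // andbT.
    by apply/asboolP; apply: XK; rewrite XE.
  by move=> k _; exact: region_area_ge0.
rewrite /total_area -/s; move: lower upper.
move: (\esum_(k in K_set c d) _)%E => [x| |] /=.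
- by rewrite !lee_fin => -> ->.
- by rewrite leye_eq.
- by rewrite leeNy_eq.
Qed.

Lemma partial_area_ge0 M : 0 <= partial_area M.
Proof. by apply: sumr_ge0 => k _; exact: region_area_ge0. Qed.

Definition tuple_count Q : nat :=
  count (fun p => coprime p.1 p.2 && residue_tuple c d Q p) (triangle_points Q).

(** Each point is counted by its own index vector, whose entries are at most 2 Q. For a vector of
    [K_set], the residues of the first two denominators force all the others. *)
Lemma tuple_countE Q : (tuple_count Q)%:R =
  \sum_(k <- bounded_tuples s (2 * Q) | inK k) (region_count k d (cn 0) (cn 1) Q)%:R :> R.
Proof.
rewrite /tuple_count natr_count.
under [RHS]eq_bigr do rewrite /region_count natr_count.
rewrite exchange_big /= !big_seq; apply: eq_bigr => p; rewrite mem_triangle_points => D.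
case cp: (coprime p.1 p.2) => /=; last by rewrite big1.
have sr : s.+2 = r by rewrite /s; lia.
have [r0 r1] : (0 < r)%N /\ (1 < r)%N by lia.
have res k : inK k -> k_seq s Q p == k -> (p.1 == cn 0 %[mod d])%N && (p.2 == cn 1 %[mod d])%N =
    residue_tuple c d Q p.
  move=> /K_setP[Q0 [p0 [D0 c0 kE H0]]] /eqP Ek.
  have Ek' : k_seq s Q p = k_seq s Q0 p0 by rewrite kE.
  apply/andP/forallP => [[/eqP e1 /eqP e2] j|H].
    apply/eqP; rewrite (tnth_nth 0%N) -/(cn j) -H0 //.
    by apply: (q_pair_congr D D0 Ek' (leq0n s)); rewrite ?sr // H0.
  split.
    by have := H (Ordinal r0); rewrite (tnth_nth 0%N).
  by have := H (Ordinal r1); rewrite (tnth_nth 0%N).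
case: (boolP (residue_tuple c d Q p)) => Hres.
  have Kk := K_set_k_vec D cp Hres.
  have kin : k_vec s Q p \in bounded_tuples s (2 * Q).
    rewrite mem_bounded_tuples; apply/allP => x.
    rewrite val_k_vec => /mapP[i _ ->] /=.
    have [_] := index_natP (q_pair_triangle i D).
    by have /and3P[] := q_pair_triangle i D; nia.
  rewrite -big_filter (bigD1_seq (k_vec s Q p)) ?filter_uniq ?bounded_tuples_uniq //;
    last by rewrite mem_filter Kk.
  have Ek : k_seq s Q p == k_vec s Q p by rewrite val_k_vec.
  rewrite size_tuple -/s Ek (res _ Kk Ek) Hres /= big1_seq ?addr0 // => k /andP[kk _].
  rewrite size_tuple -val_k_vec -/s; case: eqP => // Ekk.
  have E : k_vec s Q p = k by exact: val_inj.
  by rewrite E eqxx in kk.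
rewrite big1 // => k Kk; rewrite size_tuple -/s; case: eqP => //= /eqP Ek.
by rewrite (res k) // (negbTE Hres).
Qed.

End Admissible.

(** * The asymptotic formula *)

Section Asymptotics.
Variable R : realType.

Definition error_scale (Q : nat) : R := Q%:R * (1 + ln Q%:R).

Lemma ln_nat_ge0 Q : (0 < Q)%N -> 0 <= ln Q%:R :> R.
Proof. by move=> Q0; rewrite ln_ge0 // ler1n. Qed.

Lemma error_scale_ge Q : (0 < Q)%N -> Q%:R <= error_scale Q.
Proof. by move=> Q0; rewrite /error_scale ler_peMr // lerDl ln_nat_ge0. Qed.

Lemma error_scale_ge1 Q : (0 < Q)%N -> 1 <= error_scale Q.
Proof. by move=> Q0; apply: le_trans (error_scale_ge Q0); rewrite ler1n. Qed.

Lemma density_norm_le d Q : (0 < d)%N -> `|density R d Q| <= 2 * Q%:R ^+ 2.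
Proof.
move=> d0; have dR : 1 <= d%:R ^+ 2 :> R by rewrite exprn_ege1 // ler1n.
rewrite /density normrM mulrC; apply: ler_pM => //; first exact: mobius_sum_norm_le.
rewrite ger0_norm ?divr_ge0 ?exprn_ge0 // ler_pdivrMr; last by apply: lt_le_trans dR.
by rewrite ler_peMr ?exprn_ge0.
Qed.

Lemma sum_inv_tail_le_ln B M : (0 < M)%N ->
  \sum_(K <- iota B.+1 (M - B)) (K%:R)^-1 <= 1 + ln M%:R :> R.
Proof.
move=> M0; apply: le_trans (sum_inv_le_ln R M0).
have [BM|MB] := leqP B M; last first.
  by rewrite (_ : (M - B)%N = 0%N) ?big_nil ?sumr_ge0 //; lia.
rewrite -[in X in _ <= X](subnKC BM) iotaD big_cat /= add1n lerDr.
by apply: sumr_ge0 => i _; rewrite invr_ge0.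
Qed.

(** [C1] collects what is multiplied by Q log Q alone: the vectors with entries at most B, each
    costing [Cs], and the truncation of the area. The vectors with a large entry K cost 210 / K
    each, giving the explicit logarithmic term. *)
Lemma tuple_count_approx (r d : nat) (c : r.-tuple nat) :
  (3 <= r)%N -> (2 <= d)%N ->
  exists2 C1 : R, 0 <= C1 & forall Q, (10 * (r - 2) + 10 <= Q)%N ->
    `|(tuple_count d c Q)%:R - total_area R c d * density R d Q|
      <= (C1 + 210 * r%:R * (1 + ln (2 * Q)%:R)) * error_scale Q.
Proof.
move=> r3 d2; set s := (r - 2)%N; set B := (10 * s + 10)%N.
have d0 : (0 < d)%N by lia.
pose Cs : R := (15 * (5 + 2 * s))%:R.
exists (Cs * (size (bounded_tuples s B))%:R + 4 * s%:R).
  by rewrite addr_ge0 ?mulr_ge0.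
move=> Q BQ; have Q0 : (0 < Q)%N by move: BQ; rewrite /B; lia.
have BM : (B <= 2 * Q)%N by lia.
have M0 : (0 < 2 * Q)%N by lia.
set M := (2 * Q)%N in BM M0 *.
have X0 : 0 <= error_scale Q by apply: le_trans (error_scale_ge1 Q0).
set X := error_scale Q in X0 *.
pose f (n : nat) : R := 210 / n%:R.
have f0 n : 0 <= f n by rewrite divr_ge0.
pose bound (k : s.-tuple nat) : R := (if all (leq^~ B) k then Cs else 0) + tail_weight r B f k.
rewrite (tuple_countE R d c r3).
set D := density R d Q.
(* Truncation at M = 2 Q loses area at most 4 s / M, and the density is at most 2 Q^2: together 4 s
   Q. *)
have areas : `|partial_area R d c M * D - total_area R c d * D| <= 4 * s%:R * X.
  rewrite -mulrBl normrM.
  have /andP[t1 t2] := total_area_bounds R d c r3 BM.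
  have h : `|partial_area R d c M - total_area R c d| <= 4 * s%:R / M%:R.
    by rewrite ler_norml; apply/andP; split; lra.
  apply: (@le_trans _ _ (4 * s%:R / M%:R * (2 * Q%:R ^+ 2))).
    by apply: ler_pM => //; exact: density_norm_le.
  rewrite (_ : _ * _ = 4 * s%:R * Q%:R).
    by rewrite ler_wpM2l ?mulr_ge0 // error_scale_ge.
  by rewrite /M natrM; field; rewrite gt_eqF // ltr0n.
have main : `|\sum_(k <- bounded_tuples s M | `[< K_set c d k >])
      (region_count k d (nth 0%N c 0) (nth 0%N c 1) Q)%:R - partial_area R d c M * D|
    <= (Cs * (size (bounded_tuples s B))%:R + 210 * r%:R * (1 + ln M%:R)) * X.
  rewrite /partial_area mulr_suml -sumrB.
  apply: (le_trans (ler_norm_sum _ _ _)).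
  apply: (@le_trans _ _ (\sum_(k <- bounded_tuples s M | `[< K_set c d k >]) bound k * X)).
    apply: ler_sum => k Kk; rewrite /bound; case: ifPn => [kB|kB].
      have := region_count_approx R k Q0 d0 (K_set_coprime r3 Kk (leq0n _)).
      rewrite size_tuple => /le_trans; apply; rewrite -/s -/Cs -/(error_scale Q) -/X.
      by rewrite ler_wpM2r // lerDl tail_weight_ge0.
    rewrite add0r; have [j js large] := tail_index kB.
    rewrite (region_count_K_set r3 Q Kk js large).
    rewrite (region_area_K_set R Kk js large).
    apply: le_trans (_ : f (nth 0%N k j) * X <= _); last first.
      by rewrite ler_wpM2r // (tail_weight_ge f0 js large).
    apply: region_count1_approx => //; first by move: large; rewrite /B; lia.
    by apply: (K_set_coprime r3 Kk); exact: ltnW.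
  rewrite -mulr_suml ler_wpM2r // big_split /= lerD //.
    rewrite -big_mkcondr /= -big_filter.
    apply: (@le_trans _ _ (\sum_(k <- bounded_tuples s B) Cs)); last first.
      by rewrite big_const_seq count_predT iter_addr_0 mulr_natr.
    apply: (@ler_sum_inj R _ _ _ _ id (fun=> Cs)) => //;
      rewrite ?filter_uniq ?bounded_tuples_uniq //.
    by move=> k; rewrite map_id mem_filter !mem_bounded_tuples => /andP[/andP[_ ->]].
  apply: (le_trans (sum_tail_weight d c r3 M (leqnn B) f0)).
  rewrite -mulr_sumr mulrCA -mulrA; apply: ler_wpM2l => //.
  apply: ler_pM => //; first by apply: sumr_ge0 => i _; rewrite invr_ge0.
    by rewrite ler_nat leq_subr.
  exact: sum_inv_tail_le_ln.
rewrite -(subrKA (partial_area R d c M * D)); apply: (le_trans (ler_normD _ _)).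
by apply: (le_trans (lerD main areas)); rewrite -mulrDl ler_wpM2r //; lra.
Qed.

(** The case of the empty index vector and d = 1, with error 75 = 15 * 5; one more unit pays for the
    last fraction, which starts no pair. *)
Lemma size_farey_approx Q : (0 < Q)%N ->
  `|(size (farey Q))%:R - Q%:R ^+ 2 / 2 * mobius_sum R 1 Q| <= 76 * error_scale Q.
Proof.
move=> Q0; have := @region_count_approx R [::] 1 0 0 Q Q0 isT isT.
rewrite region_area_nil /density expr1n divr1 (_ : (15 * _)%N = 75%N) // -/(error_scale Q).
rewrite (_ : region_count [::] 1 0 0 Q = (size (farey Q)).-1); last first.
  rewrite size_farey //=; apply: eq_count => p.
  by rewrite !modn1 eqxx !andbT.
have -> : (size (farey Q))%:R = (size (farey Q)).-1%:R + 1 :> R.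
  by rewrite natr1 prednK // size_farey.
rewrite mul1r mulrA [2^-1 * _]mulrC.
have := error_scale_ge1 Q0; move: (error_scale Q) (_.-1%:R) (_ * mobius_sum _ _ _) => X n y.
by move=> X1; rewrite !ler_norml => /andP[h1 h2]; apply/andP; split; lra.
Qed.

(** [S] and [S'] stand for the Moebius sums of 1 and d, [P] for the Euler product, [N] for the orbit
    count, [L] for 1 + ln Q. With [G] the denominator of [rho] and [m] the main term, n is compared
    with m G and the difference divided by G. *)
Lemma quotient_error (n N F S S' q d r tot P C2 Y L : R) :
  1 <= q -> 1 <= d -> 1 <= r -> 0 <= tot -> 0 <= P -> 0 <= C2 -> 0 <= Y -> 1 <= L ->
  N - r <= n <= N ->
  `|N - tot * (q ^+ 2 / d ^+ 2 * S')| <= Y * (q * L) ->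
  `|F - q ^+ 2 / 2 * S| <= 76 * (q * L) ->
  `|P * S - S'| <= C2 / q -> 4^-1 <= S -> 16 * (76 + r) * L <= q ->
  `|n / (F - (r - 1)) - 2 / d ^+ 2 * P * tot|
    <= 16 * (Y + (r + tot * C2 + 2 / d ^+ 2 * P * tot * (76 + r))) * L / q.
Proof.
move=> q1 d1 r1 tot0 P0 C20 Y0 L1 nN hN hF hS S4 big.
set m := 2 / d ^+ 2 * P * tot.
have q0 : 0 < q by lra.
have d20 : 1 <= d ^+ 2 by rewrite exprn_ege1.
have d2p : 0 < d ^+ 2 by lra.
have m0 : 0 <= m by rewrite /m !mulr_ge0 // invr_ge0 ltW.
set X := q * L in hN hF *.
have qX : q <= X by rewrite /X; nra.
have X1 : 1 <= X by lra.
set G := F - (r - 1).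
have hG : `|G - q ^+ 2 / 2 * S| <= (76 + r) * X.
  move: hF; rewrite /G !ler_norml => /andP[h1 h2].
  have : r <= r * X by nra.
  by move=> h3; apply/andP; split; lra.
(* S >= 1/4 gives a main part of at least q^2 / 8, and the largeness hypothesis on q bounds the
   error by q^2 / 16. *)
have Gq : q ^+ 2 / 16 <= G.
  move: hG; rewrite ler_norml => /andP[h1 _].
  have h2 : 16 * ((76 + r) * X) <= q ^+ 2.
    rewrite (_ : 16 * _ = q * (16 * (76 + r) * L)); last by rewrite /X; ring.
    by rewrite expr2 ler_pM2l.
  have h3 : q ^+ 2 / 2 * 4^-1 <= q ^+ 2 / 2 * S.
    by rewrite ler_wpM2l // divr_ge0 ?exprn_ge0 // ltW.
  by lra.
have q20 : 0 < q ^+ 2 by rewrite exprn_gt0.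
have G0 : 0 < G by lra.
have key : `|n - m * G| <= (Y + (r + tot * C2 + m * (76 + r))) * X.
  (* The four errors: tuples at the end of the sequence, the orbit count, the replacement of S' by P
     S, and the size of the Farey sequence. *)
  have -> : n - m * G = (n - N) + (N - tot * (q ^+ 2 / d ^+ 2 * S'))
      + (- (tot * (q ^+ 2 / d ^+ 2)) * (P * S - S')) + (- m * (G - q ^+ 2 / 2 * S)).
    by rewrite /m; field; rewrite gt_eqF //; lra.
  have e1 : `|n - N| <= r * X.
    have : r <= r * X by nra.
    by case/andP: nN => *; rewrite ler_norml; apply/andP; split; lra.
  have e3 : `|- (tot * (q ^+ 2 / d ^+ 2)) * (P * S - S')| <= tot * C2 * X.
    have t0 : 0 <= tot * (q ^+ 2 / d ^+ 2) by rewrite mulr_ge0 // divr_ge0 // ltW.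
    rewrite normrM normrN (ger0_norm t0).
    apply: (@le_trans _ _ (tot * q ^+ 2 * (C2 / q))).
      apply: ler_pM => //; apply: ler_wpM2l => //.
      by rewrite ler_pdivrMr // ler_peMr // ltW.
    rewrite (_ : _ * _ = tot * C2 * q); last by field; rewrite gt_eqF.
    by rewrite ler_wpM2l // mulr_ge0.
  have e4 : `|- m * (G - q ^+ 2 / 2 * S)| <= m * (76 + r) * X.
    rewrite normrM normrN (ger0_norm m0) (_ : m * (76 + r) * X = m * ((76 + r) * X)); last by ring.
    exact: ler_wpM2l.
  apply: (le_trans (ler_normD _ _)); apply: le_trans (lerD _ e4) _.
    apply: (le_trans (ler_normD _ _)); apply: lerD _ e3.
    by apply: (le_trans (ler_normD _ _)); apply: lerD e1 hN.
  by rewrite le_eqVlt; apply/orP; left; apply/eqP; ring.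
rewrite (_ : n / G - m = (n - m * G) / G); last by field; rewrite gt_eqF.
rewrite normrM normfV (gtr0_norm G0) ler_pdivrMr //.
apply: (le_trans key).
set Z := Y + _.
have Z0 : 0 <= Z.
  apply: addr_ge0 => //; apply: addr_ge0; last by apply: mulr_ge0 => //; lra.
  by apply: addr_ge0; [lra | exact: mulr_ge0].
rewrite (_ : _ / q * G = Z * L / q * (16 * G)); last by field; rewrite gt_eqF.
rewrite (_ : Z * X = Z * L / q * q ^+ 2); last by rewrite /X; field; rewrite gt_eqF.
rewrite ler_wpM2l //; first by rewrite divr_ge0 ?mulr_ge0 //; lra.
lra.
Qed.

Lemma ln_nat_eventually_ge (T : R) : exists N : nat, forall Q : nat, (N <= Q)%N -> T <= ln Q%:R.
Proof.
exists (Num.truncn (expR T)).+1 => Q NQ.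
rewrite -[T]expRK ler_ln ?posrE ?expR_gt0 //; last by rewrite ltr0n; lia.
by rewrite ltW // (lt_le_trans (truncnS_gt _)) // ler_nat.
Qed.

(** With x the square root of Q: ln Q = 2 ln x <= 2 x, and a <= x / 4 once Q exceeds (4 a)^2. *)
Lemma ln_nat_eventually_le (a : nat) : exists N : nat, forall Q : nat, (N <= Q)%N ->
  a%:R * (1 + ln Q%:R) <= Q%:R :> R.
Proof.
have [N1 H1] := ln_nat_eventually_ge 1.
exists (maxn N1 ((4 * a) ^ 2).+1) => Q; rewrite geq_max => /andP[/H1 L1 aQ].
have Q0 : 0 < Q%:R :> R by rewrite ltr0n; lia.
pose x : R := Num.sqrt Q%:R.
have x0 : 0 < x by rewrite sqrtr_gt0.
have xQ : x ^+ 2 = Q%:R by rewrite sqr_sqrtr // ltW.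
have lnx : ln Q%:R <= 2 * x.
  have -> : ln Q%:R = 2 * ln x by rewrite -xQ lnXn // mulr_natl.
  by apply: ler_wpM2l => //; exact/ltW/ln_sublinear.
have ax : (4 * a)%:R <= x.
  rewrite -(ler_pXn2r (isT : (0 < 2)%N)) ?nnegrE // ?(ltW x0) // xQ -natrX ler_nat.
  exact: ltnW.
rewrite natrM in ax; rewrite -xQ expr2.
have a0 : 0 <= a%:R :> R by [].
move: lnx L1; rewrite -xQ; move: (ln _) => l h1 h2.
have : a%:R * (1 + l) <= a%:R * (4 * x) by rewrite ler_wpM2l //; lra.
by move/le_trans; apply; nra.
Qed.

End Asymptotics.

Theorem theorem2 (R : realType) :
  exists C : R, forall (r d : nat) (c : r.-tuple nat),
    (3 <= r)%N -> (2 <= d)%N -> (forall j : 'I_r, (tnth c j <= d - 1)%N) ->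
    \forall Q \near \oo,
      `| rho R Q c d
         - 2 / d%:R ^+ 2
           * (\prod_(p <- primes d) (1 - 1 / p%:R ^+ 2)^-1)
           * total_area R c d |
      <= C * (r%:R * (Q%:R)^-1 * ln (Q%:R : R) ^+ 2).
Proof.
(* 13472 = 16 * 421 * 2: the 16 comes from [quotient_error]; 421 is 420, from 210 r (1 + ln (2 Q))
   <= 420 r ln Q, plus 1 for [C1 + C3 <= ln Q]; the 2 comes from 1 + ln Q <= 2 ln Q. *)
exists 13472 => r d c r3 d2 _.
have d0 : (0 < d)%N by lia.
have [C1 C10 HN] := tuple_count_approx R c r3 d2.
have [C2 HC2] : exists C2 : R, forall n, (0 < n)%N ->
    `|(\prod_(p <- primes d) (1 - 1 / p%:R ^+ 2)^-1) * mobius_sum R 1 n - mobius_sum R d n|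
      <= C2 / n%:R.
  have [|C2 H] := mobius_sum_prod R (primes_uniq d).
    by apply/allP => p; rewrite mem_primes => /andP[].
  exists C2 => n n0; have := H n n0; rewrite {3}/mobius_sum [X in _ - X]big_seq_cond.
  rewrite (eq_bigl (fun m => (m \in iota 1 n) && coprime m d)); last first.
    move=> m; case mi: (m \in iota 1 n) => //=; rewrite prod_primes_coprime //.
    by move: mi; rewrite mem_iota => /andP[].
  by rewrite -big_seq_cond.
have C20 : 0 <= C2.
  by have := HC2 1%N isT; rewrite divr1 => /(le_trans (normr_ge0 _)).
set P := \prod_(p <- primes d) _ in HC2 *; set tot := total_area R c d.
have P0 : 0 <= P.
  rewrite /P big_seq; apply: prodr_ge0 => p; rewrite mem_primes => /andP[pp _].
  by rewrite invr_ge0 ltW // prime_factor_pos.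
have tot0 : 0 <= tot.
  have /andP[h _] := total_area_bounds R d c r3 (leqnn _).
  by apply: le_trans h; exact: partial_area_ge0.
pose C3 : R := r%:R + tot * C2 + 2 / d%:R ^+ 2 * P * tot * (76 + r%:R).
(* Beyond [N1], a single logarithm dominates every constant depending on r, d and c; the summand 2
   also yields 1 + ln (2 Q) <= 2 ln Q. The threshold [N2] serves the largeness hypothesis of
   [quotient_error]. *)
have [N1 H1] := ln_nat_eventually_ge (2 + C1 + C3).
have [N2 H2] := ln_nat_eventually_le R (16 * (76 + r)).
exists (maxn (maxn N1 N2) (10 * (r - 2) + 10)) => // Q /=.
rewrite !geq_max => /andP[/andP[/H1 {}H1 /H2 {}H2] BQ].
have Q0 : (0 < Q)%N by lia.
have QR : 1 <= Q%:R :> R by rewrite ler1n.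
have r1 : 1 <= r%:R :> R by rewrite ler1n; lia.
have dR : 1 <= d%:R :> R by rewrite ler1n.
have C30 : 0 <= C3.
  rewrite /C3 !addr_ge0 ?mulr_ge0 ?invr_ge0 ?exprn_ge0 //; lra.
have lnQ : 2 <= ln Q%:R :> R by lra.
have ln2Q : 1 + ln (2 * Q)%:R <= 2 * ln Q%:R :> R.
  have : ln 2 <= 1 :> R.
    by have := @le_ln1Dx R 1; rewrite (_ : 1 + 1 = 2) //; apply; lra.
  have -> : ln (2 * Q)%:R = ln 2 + ln Q%:R :> R.
    by rewrite natrM lnM // posrE // ltr0n.
  lra.
have ln2Q0 : 0 <= 1 + ln (2 * Q)%:R :> R.
  by apply: addr_ge0; [exact: ler01 | apply: ln_ge0; rewrite ler1n muln_gt0].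
have r1' : (1 < r)%N := ltnW r3.
have /andP[n1 n2] : (num_tuples Q c d <= tuple_count d c Q <= num_tuples Q c d + r)%N.
  by apply: num_tuples_count.
have nN : (tuple_count d c Q)%:R - r%:R <= ((num_tuples Q c d)%:R : R)
    <= (tuple_count d c Q)%:R.
  by rewrite lerBlDr -natrD !ler_nat n2 n1.
have Y0 : 0 <= C1 + 210 * r%:R * (1 + ln (2 * Q)%:R).
  by rewrite addr_ge0 // !mulr_ge0.
have big : 16 * (76 + r%:R) * (1 + ln Q%:R) <= Q%:R :> R.
  by move: H2; rewrite natrM natrD.
have L1 : 1 <= 1 + ln Q%:R :> R by lra.
have := quotient_error QR dR r1 tot0 P0 C20 Y0 L1 nN
  (HN Q BQ) (size_farey_approx R Q0) (HC2 Q Q0) (mobius_sum1_ge R Q0) big.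
rewrite -/C3 /rho => /le_trans; apply.
move: (ln Q%:R) (ln (2 * Q)%:R) lnQ ln2Q ln2Q0 H1 => l l2 lnQ ln2Q ln2Q0 H1.
apply: (@le_trans _ _ (16 * (421 * r%:R * l) * (2 * l) / Q%:R)); last first.
  by rewrite le_eqVlt; apply/orP; left; apply/eqP; ring.
have hr : r%:R * (1 + l2) <= r%:R * (2 * l) by apply: ler_wpM2l => //; lra.
have hl : l <= r%:R * l by rewrite ler_peMl //; lra.
apply: ler_wpM2r; first by rewrite invr_ge0.
apply: ler_pM; [ | lra | | lra].
  by apply: mulr_ge0 => //; apply: addr_ge0 => //; apply: addr_ge0 => //; apply: mulr_ge0 => //; lra.
by apply: ler_wpM2l => //; lra.
Qed.
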